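(* Let $(X,d,\mu)$, $p$, $\underline{Q}_\mu$ be as in the context. Fix $\underline{\theta}\in[0,\min\{p,\underline{Q}_\mu\})$, $\theta\in[\underline{\theta},p)$, an integer $N\ge2$, numbers $0<\theta_1<\dots<\theta_N=\underline{\theta}$, closed sets $S^i\in\mathcal{ADR}_{\theta_i}(X)$, $S:=\bigcup_{i=1}^NS^i$, and $\mathfrak m_k:=\sum_{i=1}^N2^{k(\theta-\theta_i)}\mathcal H_{\theta_i}\lfloor_{S^i}$, $k\in\mathbb N_0$. For each $i$ let $\sigma_i\in(0,1)$ be such that $S^i$ is $\sigma_i$-porous, and put $\sigma(S):=\prod_{i=1}^N\frac{2\sigma_i}{3}$. Then for each $\sigma\in(0,\sigma(S)]$ there is a constant $C>0$ such that $$\operatorname{BN}_{p,\{\mathfrak m_k\},\sigma}(f)\le C\Big(\sum_{i=1}^N\|f|\mathrm B^{1-\theta_i/p}_p(S^i)\|+\mathcal{GL}^{(1)}_p(f)\Big)\quad\text{for all } f\in\bigcap_{i=1}^NL_p(\mathcal H_{\theta_i}\lfloor_{S^i}).$$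
   Context: Standing setting: $(X,d)$ complete separable metric space, $\mu$ a Borel regular locally finite outer measure, $\operatorname{supp}\mu=X$, uniformly locally doubling (for every $R>0$, $\sup_{r\in(0,R]}\sup_x\mu(B_{2r}(x))/\mu(B_r(x))<\infty$). Balls are closed, $B_r(x)=\{y:d(x,y)\le r\}$, $cB_r(x)=B_{cr}(x)$, $B_k(x)=B_{2^{-k}}(x)$. A fixed $p\in(1,\infty)$; $X$ supports a weak local $(1,p)$-Poincaré inequality (for every $R>0$ there are $C,\lambda\ge1$ with $\inf_c\frac{1}{\mu(B_r(x))}\int_{B_r(x)}|f-c|d\mu\le Cr(\frac{1}{\mu(B_{\lambda r}(x))}\int_{B_{\lambda r}(x)}(\operatorname{lip}f)^pd\mu)^{1/p}$ for Lipschitz $f$, $x\in X$, $r\in(0,R]$, with $\operatorname{lip}f(y)=\limsup_{z\to y}|f(y)-f(z)|/d(y,z)$). $\underline{Q}_\mu$ is the infimum of $Q>0$ such that for every $R>0$ there is $C$ with $(r_{B'}/r_B)^Q\le C\mu(B')/\mu(B)$ for balls $B'\subset B$, $0<r_{B'}\le r_B\le R$. Notation: $\mathrm{Av}_{G,\mathfrak m}(g)=\mathfrak m(G)^{-1}\int_Gg\,d\mathfrak m$ if $\mathfrak m(G)>0$, else $0$; $\mathcal E_{\mathfrak m}(g,G):=\inf_{c\in\mathbb R}\mathrm{Av}_{G,\mathfrak m}(|g-c|)$; $\mathfrak m\lfloor_S(E)=\mathfrak m(E\cap S)$. $\mathcal H_{\vartheta,\delta}(E):=\inf\{\sum\mu(B_{r_i}(x_i))r_i^{-\vartheta}:E\subset\bigcup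 B_{r_i}(x_i),0<r_i<\delta\}$, $\mathcal H_\vartheta=\lim_{\delta\to0}\mathcal H_{\vartheta,\delta}$. $\mathcal{ADR}_\vartheta(X)$: closed $S'$ with $\varkappa_1\mu(B_r(x))r^{-\vartheta}\le\mathcal H_\vartheta(B_r(x)\cap S')\le\varkappa_2\mu(B_r(x))r^{-\vartheta}$ for $x\in S'$, $r\in(0,1]$. Porosity: a ball $B$ is $(S',\sigma)$-porous if there is a ball $B'\subset B\setminus S'$ with $r(B')\ge\sigma r(B)$; $S'_r(\sigma):=\{x\in S':B_r(x)\text{ is }(S',\sigma)\text{-porous}\}$; $S'$ is $\sigma$-porous if $S'_r(\sigma)=S'$ for all $r\in(0,1]$. Besov norm: for $S'\in\mathcal{ADR}_\vartheta(X)$, $s>0$: $\|f|\mathrm B^s_p(S')\|:=\|f|L_p(\mathcal H_\vartheta\lfloor_{S'})\|+(\sum_{k\ge1}2^{ksp}\int_{S'}(\mathcal E_{\mathcal H_\vartheta\lfloor_{S'}}(f,B_k(x)))^pd\mathcal H_\vartheta(x))^{1/p}$. Functional $\operatorname{BN}$: for $r>0$ let $k(r)$ be the integer with $r\in(2^{-k(r)-1},2^{-k(r)}]$; $\widetilde{\mathcal E}_{\mathfrak m_k}(f,B_r(x)):=\mathcal E_{\mathfrak m_k}(f,B_{2r}(x))$ if $B_r(x)\cap S\ne\emptyset$ and $0$ otherwise; $f^\sharp(x):=\sup_{r\in(0,1]}\frac1r\widetilde{\mathcal E}_{\mathfrak m_{k(r)}}(f,B_r(x))$, $x\in X$. Then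 $\operatorname{BN}_{p,\{\mathfrak m_k\},\sigma}(f):=\|f|L_p(\mathfrak m_0)\|+\|f^\sharp|L_p(S,\mu)\|+\big(\sum_{k\ge1}2^{k(\theta-p)}\int_{S_{2^{-k}}(\sigma)}(\mathcal E_{\mathfrak m_k}(f,B_k(x)))^pd\mathfrak m_k(x)\big)^{1/p}$. Gluing functional: $\Sigma^{i,j}_k:=\{(y,z)\in S^i\times S^j:d(y,z)\le2^{-k}\}$, $\operatorname{w}_k(y,z):=(\mu(B_k(y))\mu(B_k(z)))^{-1/2}$, $\mathcal{GL}^{(1)}_p(f):=\big(\sum_{i\ne j}\sum_{k\ge1}2^{k(p-\theta_i-\theta_j)}\iint_{\Sigma^{i,j}_k}\operatorname{w}_k(y,z)|f(y)-f(z)|^pd\mathcal H_{\theta_i}(y)d\mathcal H_{\theta_j}(z)\big)^{1/p}$. *)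

(* Defs.v *)
From HB Require Import structures.
From mathcomp Require Import all_boot all_order all_algebra.
From mathcomp Require Import all_classical all_reals all_analysis.
Import Order.TTheory GRing.Theory Num.Theory.
Set Implicit Arguments. Unset Strict Implicit. Unset Printing Implicit Defensive.
Local Open Scope classical_set_scope.
Local Open Scope ring_scope.

Section MetricMeasure.
Context {R : realType} {d0 : measure_display} {X : measurableType d0}.
Variable dist : X -> X -> R.

Definition cball (x : X) (r : R) : set X := [set y | dist x y <= r].

Definition is_metric : Prop :=
  [/\ forall x y, 0 <= dist x y,
      forall x y, dist x y = 0 <-> x = y,
      forall x y, dist x y = dist y x &
      forall x y z, dist x z <= dist x y + dist y z].

Definition dcomplete : Prop :=
  forall u : nat -> X,
    (forall e, 0 < e -> exists M, forall m n, (M <= m)%N -> (M <= n)%N ->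
        dist (u m) (u n) < e) ->
    exists l, forall e, 0 < e -> exists M, forall n, (M <= n)%N -> dist (u n) l < e.

Definition dseparable : Prop :=
  exists D : set X, countable D /\
    forall x e, 0 < e -> exists2 y, D y & dist x y < e.

Definition dopen (A : set X) : Prop :=
  forall x, A x -> exists2 r, 0 < r & [set y | dist x y < r] `<=` A.

Definition dclosed (A : set X) : Prop :=
  forall x, (forall e, 0 < e -> exists2 y, A y & dist x y < e) -> A x.

Definition borel_sets : Prop := (@measurable d0 X) = <<s dopen >>.

Definition lipschitz (f : X -> R) : Prop :=
  exists L : R, forall x y, `|f x - f y| <= L * dist x y.

(* lip f(y) = limsup_{z -> y} |f(y)-f(z)|/d(y,z)  (0 at isolated points) *)
Definition lipf (f : X -> R) (y : X) : \bar R :=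
  ereal_inf [set ereal_sup ([set 0%E] `|`
       [set (`|f y - f z| / dist y z)%:E | z in [set z | 0 < dist y z < del]])
    | del in [set del : R | 0 < del]].

(* Av_{G,m}(g) for a "measure" given by its mass m and integration functional I *)
Definition AvE (m : set X -> \bar R) (I : set X -> (X -> \bar R) -> \bar R)
  (G : set X) (g : X -> \bar R) : \bar R :=
  if (0 < m G)%E then (((fine (m G))^-1)%:E * I G g)%E else 0%E.

Definition oscE (m : set X -> \bar R) (I : set X -> (X -> \bar R) -> \bar R)
  (f : X -> R) (G : set X) : \bar R :=
  ereal_inf [set AvE m I G (fun x => (`|f x - c|)%:E) | c in [set: R]].

Variable mu : {measure set X -> \bar R}.

Definition mu_int (G : set X) (g : X -> \bar R) : \bar R := (\int[mu]_(x in G) g x)%E.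

Definition locally_finite : Prop :=
  forall x, exists2 r, 0 < r & (mu (cball x r) < +oo)%E.

Definition full_support : Prop :=
  forall x r, 0 < r -> (0 < mu (cball x r))%E.

Definition unif_loc_doubling : Prop :=
  forall R0, 0 < R0 -> exists C : R, forall x r, 0 < r <= R0 ->
    (mu (cball x (2 * r)) <= C%:E * mu (cball x r))%E.

Definition poincare (p : R) : Prop :=
  forall R0, 0 < R0 -> exists C lam : R, 1 <= C /\ 1 <= lam /\
    forall f, lipschitz f -> forall x r, 0 < r <= R0 ->
      (oscE mu mu_int f (cball x r) <=
        (C * r)%:E * ((AvE mu mu_int (cball x (lam * r))
                         (fun y => lipf f y `^ p)) `^ p^-1))%E.

Definition Q_admissible (Q : R) : Prop :=
  0 < Q /\ forall R0, 0 < R0 -> exists C : R,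
    forall x x' r r', 0 < r' -> r' <= r -> r <= R0 ->
      cball x' r' `<=` cball x r ->
      (((r' / r) `^ Q)%:E * mu (cball x r) <= C%:E * mu (cball x' r'))%E.

Definition Q_lower : \bar R := ereal_inf [set Q%:E | Q in Q_admissible].

(* H_{vartheta,delta}: covers indexed by an arbitrary I \subset nat
   (finite or countable) *)
Definition Hcont_delta (th del : R) (E : set X) : \bar R :=
  ereal_inf [set s | exists (I : set nat) (x : nat -> X) (r : nat -> R),
      E `<=` \bigcup_(i in I) cball (x i) (r i) /\
      (forall i, I i -> 0 < r i < del) /\
      s = (\esum_(i in I) (mu (cball (x i) (r i)) * ((r i) `^ (- th))%:E))%E].

(* H_vartheta = lim_{delta -> 0} H_{vartheta,delta} (monotone, hence a sup) *)
Definition Hcont (th : R) (E : set X) : \bar R :=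
  ereal_sup [set Hcont_delta th del E | del in [set del : R | 0 < del]].

Definition ADR (th : R) (S : set X) : Prop :=
  dclosed S /\ exists k1 k2 : R, 0 < k1 /\ 0 < k2 /\
    forall x r, S x -> 0 < r <= 1 ->
      ((k1 * r `^ (- th))%:E * mu (cball x r) <= Hcont th (cball x r `&` S))%E /\
      (Hcont th (cball x r `&` S) <= (k2 * r `^ (- th))%:E * mu (cball x r))%E.

Definition porous_ball (S : set X) (sig : R) (x : X) (r : R) : Prop :=
  exists (y : X) (r' : R), sig * r <= r' /\ cball y r' `<=` cball x r `\` S.

Definition porous_part (S : set X) (sig r : R) : set X :=
  [set x | S x /\ porous_ball S sig x r].

Definition porous (S : set X) (sig : R) : Prop :=
  forall r, 0 < r <= 1 -> porous_part S sig r = S.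

Section Family.
Variables (N : nat) (p theta : R) (th : 'I_N -> R) (S : 'I_N -> set X)
  (H : 'I_N -> {measure set X -> \bar R}).

Definition Sall : set X := \bigcup_(i in [set: 'I_N]) S i.

Definition coef (k : nat) (i : 'I_N) : R := 2 `^ (k%:R * (theta - th i)).

Definition mk_mass (k : nat) (G : set X) : \bar R :=
  (\sum_(i < N) (coef k i)%:E * H i (G `&` S i))%E.

Definition mk_int (k : nat) (G : set X) (g : X -> \bar R) : \bar R :=
  (\sum_(i < N) (coef k i)%:E * \int[H i]_(x in G `&` S i) g x)%E.

Definition Etilde (f : X -> R) (k : nat) (r : R) (x : X) : \bar R :=
  if `[< cball x r `&` Sall !=set0 >] then oscE (mk_mass k) (mk_int k) f (cball x (2 * r))
  else 0%E.

(* f^sharp(x) = sup_{r in (0,1]} r^{-1} \tilde E_{m_{k(r)}}(f,B_r(x)),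
   where k(r) is the integer with r in (2^{-k-1}, 2^{-k}] *)
Definition fsharp (f : X -> R) (x : X) : \bar R :=
  ereal_sup [set v | exists (k : nat) (r : R),
     [/\ 2 ^- k.+1 < r, r <= 2 ^- k, 0 < r <= 1 &
         v = ((r^-1)%:E * Etilde f k r x)%E]].

Definition BN (sigma : R) (f : X -> R) : \bar R :=
  (mk_int 0 [set: X] (fun x => (`|f x| `^ p)%:E) `^ p^-1
   + (\int[mu]_(x in Sall) (fsharp f x `^ p)) `^ p^-1
   + (\sum_(1 <= k <oo)
        (2 `^ (k%:R * (theta - p)))%:E *
        mk_int k (porous_part Sall sigma (2 ^- k))
          (fun x => oscE (mk_mass k) (mk_int k) f (cball x (2 ^- k)) `^ p)) `^ p^-1)%E.

Definition Besov (i : 'I_N) (s : R) (f : X -> R) : \bar R :=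
  ((\int[H i]_(x in S i) (`|f x| `^ p)%:E) `^ p^-1
   + (\sum_(1 <= k <oo)
        (2 `^ (k%:R * s * p))%:E *
        \int[H i]_(x in S i)
          (oscE (fun G => H i (G `&` S i))
                (fun G g => \int[H i]_(y in G `&` S i) g y)
                f (cball x (2 ^- k)) `^ p)) `^ p^-1)%E.

Definition wk (k : nat) (y z : X) : R :=
  (fine (mu (cball y (2 ^- k))) * fine (mu (cball z (2 ^- k)))) `^ (- 2^-1).

Definition GL1 (f : X -> R) : \bar R :=
  (\sum_(i < N) \sum_(j < N | i != j) \sum_(1 <= k <oo)
     (2 `^ (k%:R * (p - th i - th j)))%:E *
     \int[H i]_(y in S i) \int[H j]_(z in S j)
        (if (dist y z <= 2 ^- k)%R then (wk k y z * `|f y - f z| `^ p)%:E else 0))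
  `^ p^-1.

Definition in_Lp_all (f : X -> R) : Prop :=
  forall i, measurable_fun (S i) f /\
    (\int[H i]_(x in S i) (`|f x| `^ p)%:E < +oo)%E.

End Family.
End MetricMeasure.

(* Main.v *)
(** Since [th i > 0], a set with locally finite codimension-[th i] Hausdorff
    content is [mu]-null, so the [f^sharp] term of [BN] vanishes, and the first
    term is a sum of [L_p] norms.  In the third term the porous part is simply
    enlarged to [S].  For [x] in [S i] and [B = B_k(x)], regularity makes all the
    masses [coef k j * H j (B `&` S j)] at most a constant times the [i]-th one;
    comparing [f] on [S j] with [f] on [S i] inside [B] then gives
      [E_{m_k}(f,B)^p <= C (E_{H i}(f,B)^p + J)],
    where [J] averages [|f y - f z|^p] over [y] in [B `&` S i], [z] in
    [B `&` S j], [j != i].  Integrating in [x] and exchanging the integrals by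
    Tonelli turns [J] into the gluing energy at scale [k - 1], as two points of
    [B_k(x)] are [2^(1-k)]-close.  At [k = 1] that energy is not part of [GL1];
    there the [L_p] norms suffice.

    Oscillations need not be measurable in [x], and [\int] of a nonnegative
    function is then a lower integral; it is still monotone, and subadditive as
    soon as one of the two summands is measurable. *)

Require Import Defs.
From HB Require Import structures.
From mathcomp Require Import all_boot all_order all_algebra.
From mathcomp Require Import all_classical all_reals all_analysis.
From mathcomp Require Import measurable_realfun.
From mathcomp Require Import ring lra.
Import Order.TTheory GRing.Theory Num.Theory.
Import numFieldNormedType.Exports.
Set Implicit Arguments. Unset Strict Implicit. Unset Printing Implicit Defensive.
Local Open Scope classical_set_scope.
Local Open Scope ring_scope.

(** * Lower integrals *)

Section LowerIntegral.
Local Open Scope ereal_scope.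
Context d (T : measurableType d) (R : realType).
Variable mu : {measure set T -> \bar R}.
Import HBNNSimple.

(** The integral of a nonnegative function is a supremum over simple functions below its extension
    by zero, so every simple function admissible on the left is admissible on the right, be the
    integrands measurable or not. *)
Lemma ge0_le_integralS (D E : set T) (f g : T -> \bar R) :
  (forall x, D x -> 0 <= f x) -> (forall x, E x -> 0 <= g x) ->
  D `<=` E -> (forall x, D x -> f x <= g x) ->
  \int[mu]_(x in D) f x <= \int[mu]_(x in E) g x.
Proof.
move=> f0 g0 DE fg; rewrite !ge0_integralE//; apply: ereal_sup_le => _ [h/= hf <-].
exists h => // x; apply: (le_trans (hf x)); rewrite /patch.
case: ifPn => [/set_mem Dx|_]; first by rewrite mem_set; [exact: fg|exact: DE].
by case: ifPn => [/set_mem /g0|].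
Qed.

(** The integrand lies below the constant [+oo], whose integral is [+oo * 0 = 0]. This applies to
    [fsharp], of unknown measurability. *)
Lemma ge0_null_set_integral (D : set T) (f : T -> \bar R) : measurable D ->
  mu D = 0 -> (forall x, D x -> 0 <= f x) -> \int[mu]_(x in D) f x = 0.
Proof.
move=> mD D0 f0; apply/eqP; rewrite eq_le integral_ge0// andbT.
apply: (@le_trans _ _ (\int[mu]_(x in D) +oo)).
  by apply: ge0_le_integralS => // x _; rewrite leey.
by rewrite integral_cst// D0 mule0.
Qed.

(** Lower integrals are subadditive when one summand, here [g], is measurable: for a simple [s]
    below [e], the positive part [w] of [s / C - g] is measurable and lies below [h], hence its
    integral is at most that of [h]. *)
Lemma ge0_integral_le_affine (D : set T) (C : R) (e h g : T -> \bar R) :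
  measurable D -> (0 < C)%R ->
  (forall x, D x -> 0 <= e x) -> (forall x, D x -> 0 <= h x) ->
  (forall x, D x -> 0 <= g x) -> measurable_fun D g ->
  (forall x, D x -> e x <= C%:E * (h x + g x)) ->
  \int[mu]_(x in D) e x <= C%:E * (\int[mu]_(x in D) h x + \int[mu]_(x in D) g x).
Proof.
move=> mD C0 e0 h0 g0 mg ehg.
rewrite ge0_integralE//; apply: ge_ereal_sup => _ [s /= se <-].
(* Being below the extension of [e] by zero, [s] vanishes off [D], so its integral over the whole
   space is an integral over [D]. *)
have sD x : ~ D x -> s x = 0%R.
  move=> nDx; have := se x; rewrite /patch memNset// lee_fin => sx0.
  by apply/eqP; rewrite eq_le sx0/=; exact: fun_ge0.
have ms : measurable_fun D (fun x => (s x)%:E).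
  by apply/measurable_EFinP; apply: measurable_funS (measurable_funPT s).
have -> : sintegral mu s = \int[mu]_(x in D) (s x)%:E.
  rewrite integral_nnsfun//; congr sintegral; apply/funext => x; rewrite /patch.
  by case: ifPn => // /negP nDx; apply: sD => Dx; apply: nDx; exact: mem_set.
pose t x := (C^-1 * s x)%:E.
have mt : measurable_fun D t.
  apply/measurable_EFinP; apply: measurable_funM => //.
  by apply: measurable_funS (measurable_funPT s).
have t0 x : 0 <= t x by rewrite lee_fin mulr_ge0// invr_ge0 ltW.
have sE x : (s x)%:E = C%:E * t x by rewrite -EFinM mulrA divff ?mul1r// gt_eqF.
under eq_integral do rewrite sE.
rewrite ge0_integralZl//; last by rewrite lee_fin ltW.
rewrite lee_pmul2l//.
(* [w] is the least nonnegative function with [t <= w + g], so [t <= h + g] forces [w <= h]; where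
   [g] is [+oo] it equals 0. *)
pose w x := maxe (t x - g x) 0.
have mw : measurable_fun D w.
  by apply: measurable_maxe => //; apply: emeasurable_funB.
have w0 x : 0 <= w x by rewrite le_max lexx orbT.
apply: (@le_trans _ _ (\int[mu]_(x in D) (w x + g x))).
  apply: ge0_le_integral => //; first exact: emeasurable_funD.
  move=> x Dx; have [->|gx] := eqVneq (g x) +oo.
    by rewrite addey ?leey// -ltNye (lt_le_trans _ (w0 x)).
  have gfin : g x \is a fin_num by rewrite ge0_fin_numE ?g0// ltey.
  by rewrite -leeBlDr// /w le_max lexx.
rewrite ge0_integralD//.
apply: leeD => //; apply: ge0_le_integralS => // x Dx.
rewrite /w ge_max h0// andbT; have [->|gx] := eqVneq (g x) +oo.
  by rewrite leNye.
have gfin : g x \is a fin_num by rewrite ge0_fin_numE ?g0// ltey.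
rewrite leeBlDr// -(@lee_pmul2l _ C%:E)// -sE; apply: le_trans (ehg _ Dx).
by have := se x; rewrite /patch mem_set.
Qed.

(** Multiplying a simple function by the indicator of [S] turns its integral for the restricted
    measure into one for [mu]; this matches the two suprema without measurability of [f]. *)
Lemma ge0_integral_mrestr (S D : set T) (mS : measurable S) (f : T -> \bar R) :
  (forall x, D x -> 0 <= f x) ->
  \int[mrestr mu mS]_(x in D) f x = \int[mu]_(x in D `&` S) f x.
Proof.
move=> f0.
have sE (h : {nnsfun T >-> R}) :
    sintegral (mrestr mu mS) h = sintegral mu (proj_nnsfun h mS).
  rewrite !sintegralET; apply: eq_fsbigr => r _.
  (* At level 0 the two level sets differ off [S], but that level is weighted by 0. *)
  have [->|r0] := eqVneq r 0%R; first by rewrite !mul0e.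
  congr (_ * mu _); apply/seteqP; split => x /=.
    by case=> hx Sx; rewrite mindicE mem_set// mulr1.
  rewrite mindicE; case: (boolP (x \in S)) => [/set_mem Sx|_].
    by rewrite mulr1.
  by rewrite mulr0 => /esym/eqP; rewrite (negbTE r0).
rewrite !ge0_integralE//; last by move=> x [/f0].
apply/eqP; rewrite eq_le; apply/andP; split.
  apply: ge_ereal_sup => _ [h /= hf <-]; apply: ereal_sup_ubound.
  exists (proj_nnsfun h mS) => //= x.
  rewrite mindicE /patch; case: (boolP (x \in S)) => xS.
    rewrite mulr1 (le_trans (hf x))// /patch in_setI xS andbT.
    by [].
  by rewrite mulr0 in_setI (negbTE xS) andbF.
apply: ge_ereal_sup => _ [h /= hf <-]; apply: le_ereal_sup_tmp.
exists (sintegral (mrestr mu mS) h); last first.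
  rewrite sE le_sintegral// => x /=; rewrite mindicE.
  have := hf x; rewrite /patch; case: ifPn => [|_].
    by rewrite in_setI => /andP[_ ->]; rewrite mulr1.
  rewrite lee_fin => hx; apply: (le_trans hx); apply: mulr_ge0 => //.
exists h => //= x; apply: (le_trans (hf x)); rewrite /patch in_setI.
case: (boolP (x \in D)) => //= /set_mem Dx; case: ifP => // _; exact: f0.
Qed.

End LowerIntegral.

(** * Balls, coverings and null sets *)

Section MetricBorel.
Context {R : realType} {d0 : measure_display} {X : measurableType d0}.
Variable dist : X -> X -> R.
Hypotheses (dm : is_metric dist) (dsep : dseparable dist)
  (dbor : borel_sets dist).

Lemma measurable_dopen (A : set X) : dopen dist A -> measurable A.
Proof. by move=> oA; rewrite dbor; exact: sub_sigma_algebra. Qed.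

Lemma measurable_dclosed (A : set X) : dclosed dist A -> measurable A.
Proof.
move=> cA; rewrite -[A]setCK; apply: measurableC; apply: measurable_dopen.
move=> x nAx; apply: contrapT => H; apply: nAx; apply: cA => e e0.
apply: contrapT => nH; apply: H; exists e => // y /= xy Ay.
by apply: nH; exists y.
Qed.

Lemma measurable_cball x r : measurable (cball dist x r).
Proof.
have [d_ge0 _ dC dT] := dm.
apply: measurable_dclosed => y ye; rewrite /cball /=.
apply/ler_addgt0Pr => e e0; have [z xz yz] := ye _ e0.
rewrite (le_trans (dT x z y))// lerD//; by rewrite dC ltW.
Qed.

Lemma dball_measurable x r : measurable [set y | dist x y < r].
Proof.
have [d_ge0 _ dC dT] := dm.
apply: measurable_dopen => y /= xy; exists (r - dist x y); first by rewrite subr_gt0.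
by move=> z /= yz; rewrite (le_lt_trans (dT x y z))// -ltrBrDl.
Qed.

(** The fibres of an injection of the dense set into [nat] are empty or singletons; this form needs
    no case split on whether the dense set is finite. *)
Lemma dense_cover : exists2 u : nat -> set X,
  (forall n, u n = set0 \/ exists x, u n = [set x]) &
  (forall x e, 0 < e -> exists n, exists2 y, u n y & dist x y < e).
Proof.
have [D [/countable_injP[g ginj] Dd]] := dsep.
exists (fun n => D `&` g @^-1` [set n]).
  move=> n; have [[x [Dx gx]]|H] := pselect (exists x, D x /\ g x = n); last first.
    by left; apply/seteqP; split => // x [Dx gx]; apply: H; exists x.
  right; exists x; apply/seteqP; split => [y [Dy gy]|y ->] //=.
  by apply: ginj; rewrite ?inE// gy.
move=> x e e0; have [y Dy xy] := Dd x e e0; exists (g y); by exists y.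
Qed.

Lemma cball_cover r : 0 < r -> exists2 F : nat -> set X,
  (forall n, F n = set0 \/ exists x, F n = cball dist x r) &
  \bigcup_n F n = setT.
Proof.
have [d_ge0 _ dC dT] := dm.
move=> r0; have [u u1 ud] := dense_cover.
exists (fun n => \bigcup_(x in u n) cball dist x r).
  move=> n; have [->|[x ->]] := u1 n; first by left; rewrite bigcup_set0.
  by right; exists x; rewrite bigcup_set1.
apply/seteqP; split => // x _; have [n [y uy xy]] := ud x _ r0.
by exists n => //; exists y => //; rewrite /cball/= dC ltW.
Qed.

Lemma sigma_finite_cball (nu : {measure set X -> \bar R}) r : 0 < r ->
  (forall x, nu (cball dist x r) < +oo)%E -> sigma_finite setT nu.
Proof.
move=> r0 nufin; have [F FE FT] := cball_cover r0; exists F => // n.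
have [->|[x ->]] := FE n; first by rewrite measure0.
by split; [exact: measurable_cball|exact: nufin].
Qed.

Lemma null_set_cball (nu : {measure set X -> \bar R}) r (A : set X) : 0 < r ->
  measurable A -> (forall x, nu (cball dist x r `&` A) = 0)%E -> nu A = 0%E.
Proof.
move=> r0 mA nu0; have [F FE FT] := cball_cover r0.
have mF n : measurable (F n).
  by have [->|[x ->]] := FE n => //; exact: measurable_cball.
apply/eqP; rewrite -measure_le0.
apply: (@le_trans _ _ (\sum_(0 <= n <oo) nu (F n `&` A))%E).
  apply: measure_sigma_subadditive => //.
    by move=> n; exact: measurableI.
  by rewrite -setI_bigcupl FT setTI.
rewrite eseries0// => n _ _.
by have [->|[x ->]] := FE n; rewrite ?set0I ?measure0.
Qed.

(** Separability makes the complement a countable union of rectangles: if [dist x y > r], a dense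
    point [q] closer to [x] than [1/(m+1) < (dist x y - r)/2] satisfies [dist q y > r + 1/(m+1)]. *)
Lemma measurable_dist_le r : measurable [set z : X * X | dist z.1 z.2 <= r].
Proof.
have [d_ge0 _ dC dT] := dm.
have [u u1 ud] := dense_cover.
rewrite -[X in measurable X]setCK; apply: measurableC.
rewrite (_ : ~` _ = \bigcup_m \bigcup_n \bigcup_(q in u n)
   ([set x | dist q x < (m.+1%:R^-1 : R)] `*` ~` cball dist q (r + (m.+1%:R^-1 : R)))).
  apply: bigcupT_measurable => m; apply: bigcupT_measurable => n.
  have [->|[q ->]] := u1 n; first by rewrite bigcup_set0.
  rewrite bigcup_set1; apply: measurableX; first exact: dball_measurable.
  by apply: measurableC; exact: measurable_cball.
apply/seteqP; split => -[x y] /=.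
  move=> /negP; rewrite -ltNge => rxy.
  have e0 : 0 < (dist x y - r) / 2 by rewrite divr_gt0// subr_gt0.
  have [m me] : exists m : nat, m.+1%:R^-1 < (dist x y - r) / 2 :> R.
    have := near_infty_natSinv_lt (PosNum e0).
    by move=> [m _ /(_ m (leqnn _))] ?; exists m.
  have m0 : 0 < m.+1%:R^-1 :> R by rewrite invr_gt0.
  have [n [q uq xq]] := ud x _ m0.
  exists m => //; exists n => //; exists q => //; split => /=; first by rewrite dC.
  rewrite /cball/= => qy; have := dT x q y.
  move: m0 me xq qy; generalize (m.+1%:R^-1 : R) => t; lra.
move=> [m _ [n _ [q uq [/= qx /negP]]]]; rewrite /cball/= -ltNge => qy.
apply/negP; rewrite -ltNge; have := dT q x y.
by move: qx qy; generalize (m.+1%:R^-1 : R) => t; lra.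
Qed.

End MetricBorel.

Section Balls.
Context {R : realType} {d0 : measure_display} {X : measurableType d0}.
Variables (dist : X -> X -> R) (mu : {measure set X -> \bar R}).
Hypotheses (dm : is_metric dist) (dsep : dseparable dist)
  (dbor : borel_sets dist).

(** A small ball of finite measure is doubled until its radius exceeds [r]. *)
Lemma cball_lty : locally_finite dist mu -> unif_loc_doubling dist mu ->
  forall x r, (mu (cball dist x r) < +oo)%E.
Proof.
move=> lf db x r; have [s s0 sfin] := lf x.
have fin_step (t : R) : 0 < t -> (mu (cball dist x t) < +oo)%E ->
    (mu (cball dist x (2 * t)) < +oo)%E.
  (* The doubling constant may depend on [t]; only finiteness is carried along the iteration. *)
  move=> t0 tfin; have [C HC] := db t t0.
  apply: (le_lt_trans (HC x t _)); first by rewrite t0 lexx.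
  have : mu (cball dist x t) \is a fin_num by rewrite ge0_fin_numE.
  by move=> /fineK <-; rewrite -EFinM ltry.
have fin_iter n : (mu (cball dist x (2 ^+ n * s)) < +oo)%E.
  elim: n => [|n IH]; first by rewrite expr0 mul1r.
  by rewrite exprS -mulrA; apply: fin_step => //; rewrite mulr_gt0// exprn_gt0.
have [n rn] : exists n, r <= 2 ^+ n * s.
  exists (Num.truncn `|r / s|).+1; rewrite -ler_pdivrMr//.
  apply: (le_trans (ler_norm _)); apply: ltW.
  apply: (lt_trans (truncnS_gt _)).
  by rewrite -natrX ltr_nat ltn_expl.
apply: le_lt_trans (fin_iter n); apply: le_measure; rewrite ?inE.
- exact: measurable_cball.
- exact: measurable_cball.
- by move=> y /= /le_trans; apply.
Qed.

(** [cball y (2 * r)] lies in [cball x (4 * r)]; two doublings, at radii [2 * r] and [r], both at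
    most 2, return to [cball x r]. *)
Lemma doubling_near : unif_loc_doubling dist mu -> exists2 C : R, 1 <= C &
  forall x y r, 0 < r <= 1 -> dist x y <= 2 * r ->
    (mu (cball dist y (2 * r)) <= C%:E * mu (cball dist x r))%E.
Proof.
have [d_ge0 _ dC dT] := dm.
move=> db; have [C HC] := db 2 (ltr0n _ 2).
pose K := Num.max 1 C; have K1 : 1 <= K by rewrite le_max lexx.
have HK x r : 0 < r <= 2 -> (mu (cball dist x (2 * r)) <= K%:E * mu (cball dist x r))%E.
  move=> r2; apply: (le_trans (HC x r r2)); apply: lee_wpmul2r => //.
  by rewrite lee_fin le_max lexx orbT.
exists (K * K); first by rewrite -[leLHS]mulr1 ler_pM.
move=> x y r /andP[r0 r1] xy.
apply: (@le_trans _ _ (mu (cball dist x (2 * (2 * r))))).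
  apply: le_measure; rewrite ?inE; [exact: measurable_cball..|].
  rewrite /cball => z /= yz; apply: (le_trans (dT x y z)); lra.
apply: (le_trans (HK _ _ _)); first by apply/andP; split; lra.
rewrite EFinM -muleA; apply: lee_wpmul2l; first by rewrite lee_fin (le_trans ler01).
by apply: HK; apply/andP; split; lra.
Qed.

(** For a cover by balls of radius below [del], [1 <= del ^ th * r_i ^ (- th)], so [mu E] is at most
    [del ^ th] times the weighted sum. Hence [mu E <= del ^ th * Hcont th E], which tends to 0 with
    [del]. *)
Lemma Hcont_lty_null (th : R) (E : set X) : 0 < th -> measurable E ->
  (Hcont dist mu th E < +oo)%E -> mu E = 0%E.
Proof.
move=> th0 mE Hfin.
have H0 : (0 <= Hcont dist mu th E)%E.
  apply: (@le_trans _ _ (Hcont_delta dist mu th 1 E)).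
    apply: le_ereal_inf_tmp => _ [I [x [r [_ [_ ->]]]]]; apply: esum_ge0 => i Ii.
    by rewrite mule_ge0// lee_fin powR_ge0.
  by apply: ereal_sup_ubound; exists 1 => //=.
pose M := fine (Hcont dist mu th E).
have ME : Hcont dist mu th E = M%:E by rewrite /M fineK// ge0_fin_numE.
have key del : 0 < del -> (mu E <= (del `^ th)%:E * M%:E)%E.
  move=> del0; rewrite -ME.
  have dth : 0 < del `^ th by rewrite powR_gt0.
  rewrite -lee_pdivrMl//.
  apply: (@le_trans _ _ (Hcont_delta dist mu th del E)); last first.
    by apply: ereal_sup_ubound; exists del.
  apply: le_ereal_inf_tmp => _ [I [x [r [EI [rI ->]]]]].
  have w0 i : (0 <= mu (cball dist (x i) (r i)) * (r i `^ (- th))%:E)%E.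
    by rewrite mule_ge0// lee_fin powR_ge0.
  rewrite lee_pdivrMl// esum_mkcond -nneseries_esumT -?nneseriesZl; last 2 first.
  - by move=> i _; case: ifP.
  - by move=> i; case: ifP.
  (* Indices outside [I] carry the empty set, so the cover becomes a sequence. *)
  pose F i := if i \in I then cball dist (x i) (r i) else set0.
  have mF i : measurable (F i).
    by rewrite /F; case: ifP => // _; exact: measurable_cball.
  apply: (@le_trans _ _ (\sum_(0 <= i <oo) mu (F i))%E).
    apply: measure_sigma_subadditive => // y Ey.
    have [i Ii yi] := EI y Ey; exists i => //.
    by rewrite /F mem_set.
  apply: lee_nneseries => // i _; rewrite /F.
  case: ifPn => [/set_mem Ii|_]; last by rewrite measure0 mule0.
  rewrite muleCA -[leLHS]mule1; apply: lee_wpmul2l => //.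
  rewrite -EFinM lee_fin powRN; have /andP[r0 rd] := rI i Ii.
  rewrite ler_pdivlMr ?powR_gt0// mul1r ge0_ler_powR ?nnegrE ?ltW//.
apply/eqP; rewrite -measure_le0; apply/lee_addgt0Pr => e e0; rewrite add0e.
have M1 : 0 < M + 1.
  by rewrite ltr_wpDl// /M fine_ge0.
(* This [del] has [del ^ th = e / (M + 1)], so the bound is [e * M / (M + 1) <= e]; adding 1 covers
   [M = 0]. *)
have := key ((e / (M + 1)) `^ th^-1).
rewrite powR_gt0 ?divr_gt0// => /(_ isT) /le_trans; apply.
rewrite -powRrM mulVf ?gt_eqF// powRr1; last by rewrite ltW// divr_gt0.
rewrite -EFinM lee_fin -mulrA ler_piMr//; first exact: ltW.
by rewrite mulrC ler_pdivrMr// mul1r lerDl.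
Qed.

(** Regularity speaks of centres in [S] only. If [cball x r] meets [S] at [y], it lies in
    [cball y (2 * r)], where regularity applies since [2 * r <= 1]; doubling then returns to the
    centre [x]. *)
Lemma ADR_upper (th : R) (S : set X) (H : {measure set X -> \bar R}) :
  unif_loc_doubling dist mu -> 0 < th -> ADR dist mu th S ->
  (forall A, measurable A -> H A = Hcont dist mu th A) ->
  exists2 K : R, 0 < K & forall x r, 0 < r <= 2^-1 ->
    (H (cball dist x r `&` S) <= (K * r `^ (- th))%:E * mu (cball dist x r))%E.
Proof.
have [d_ge0 _ dC dT] := dm.
move=> db th0 [/(measurable_dclosed dbor) mS [k1 [k2 [k10 [k20 HS]]]]] HE.
have [C C1 HC] := doubling_near db.
have C0 : 0 < C by rewrite (lt_le_trans ltr01).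
exists (k2 * C) => [|x r /andP[r0 r2]]; first exact: mulr_gt0.
have [[y [xy Sy]]|nxy] := pselect (cball dist x r `&` S !=set0); last first.
  rewrite (_ : _ `&` S = set0) ?measure0; last first.
    by apply/eqP/negPn/negP => /set0P.
  by rewrite mule_ge0// lee_fin !mulr_ge0 ?powR_ge0//; exact: ltW.
apply: (@le_trans _ _ (H (cball dist y (2 * r) `&` S))).
  apply: le_measure; rewrite ?inE.
  - by apply: measurableI => //; exact: measurable_cball.
  - by apply: measurableI => //; exact: measurable_cball.
  - move=> z [/= xz Sz]; split => //; apply: (le_trans (dT y x z)).
    move: xy; rewrite /cball/= => xy; rewrite (dC y x); move: xz; rewrite /cball/=; lra.
rewrite HE; last by apply: measurableI => //; exact: measurable_cball.
have r21 : 0 < 2 * r <= 1 by apply/andP; split; lra.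
apply: (le_trans (HS y (2 * r) Sy r21).2).
have rr : (2 * r) `^ (- th) <= r `^ (- th).
  by rewrite !powRN lef_pV2 ?posrE ?powR_gt0 ?ge0_ler_powR ?nnegrE//; lra.
apply: (@le_trans _ _ ((k2 * r `^ (- th))%:E * mu (cball dist y (2 * r)))%E).
  by apply: lee_wpmul2r => //; rewrite lee_fin ler_pM2l.
rewrite (mulrAC k2) [X in (_ <= X * _)%E]EFinM -muleA; apply: lee_wpmul2l.
  by rewrite lee_fin mulr_ge0 ?powR_ge0//; exact: ltW.
apply: HC; last by move: xy; rewrite /cball/=; lra.
by apply/andP; split; lra.
Qed.

End Balls.

(** * Comparison of averages over one ball *)

Lemma sume_const_ord (R : realType) (n : nat) (x : \bar R) : (0 <= x)%E ->
  (\sum_(j < n) x = n%:R%:E * x)%E.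
Proof.
move=> x0; elim: n => [|n IH]; first by rewrite big_ord0 mul0e.
by rewrite big_ord_recr/= IH -natr1 EFinD ge0_muleDl ?lee_fin// mul1e.
Qed.

Section Young.
Context {R : realType}.
Implicit Types (p lam A : R).

(** For [t > lam], [t = t ^ (1 - p) * t ^ p] and [1 - p < 0]. The free parameter [lam] does the work
    of Hölder: the bound can be integrated term by term and [lam] chosen afterwards. *)
Lemma ler_young p lam t : 1 < p -> 0 < lam -> 0 <= t ->
  t <= lam `^ (1 - p) * t `^ p + lam.
Proof.
move=> p1 lam0 t0; have [tl|lt] := leP t lam.
  by rewrite ler_wpDl// mulr_ge0// powR_ge0.
apply: ler_wpDr; first exact: ltW.
have t0' : 0 < t by rewrite (lt_trans lam0).
rewrite -(mulr_powRB1 (p := p)) ?(lt_trans ltr01)// mulrCA -[leLHS]mulr1 ler_pM2l//.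
rewrite -opprB powRN mulrC ler_pdivlMr ?powR_gt0// mul1r.
apply: ge0_ler_powR; rewrite ?nnegrE ?subr_ge0; exact: ltW.
Qed.

(* Choosing [lam = t] with [t `^ p] slightly above [inf U `^ p + J] makes the
   three terms of the hypothesis comparable to [A * t]. *)
Lemma poweR_inf_young p A (e J : \bar R) (U : R -> \bar R) :
  1 < p -> 1 <= A -> (0 <= e)%E -> (forall c, 0 <= U c)%E -> (0 <= J)%E ->
  (forall c lam, 0 < lam ->
    (e <= A%:E * U c + (lam `^ (1 - p))%:E * J + (lam * A)%:E)%E) ->
  (e `^ p <= ((3 * A) `^ p)%:E * (ereal_inf [set U c | c in [set: R]] `^ p + J))%E.
Proof.
move=> p1 A1 e0 U0 J0 H.
have p0 : 0 < p by rewrite (lt_trans ltr01).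
have A0 : 0 < A by rewrite (lt_le_trans ltr01).
have K0 : 0 < (3 * A) `^ p by rewrite powR_gt0// mulr_gt0.
set u := ereal_inf _.
have u0 : (0 <= u)%E by apply: le_ereal_inf_tmp => _ [c _ <-].
have [uy|uy] := eqVneq u +oo%E.
  rewrite uy poweRyr ?gt_eqF// addye; last by rewrite gt_eqF// (lt_le_trans _ J0).
  by rewrite gt0_muley ?leey// lte_fin.
have [Jy|Jy] := eqVneq J +oo%E.
  rewrite Jy addey; last by rewrite gt_eqF// (lt_le_trans _ (poweR_ge0 _ _)).
  by rewrite gt0_muley ?leey// lte_fin.
have ufin : u \is a fin_num by rewrite ge0_fin_numE// ltey.
have Jfin : J \is a fin_num by rewrite ge0_fin_numE// ltey.
move: ufin Jfin H u0 J0 => /fineK uE /fineK; move: (fine J) => j <-.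
move: uE; move: (fine u) => v uE H u0; rewrite lee_fin => j0.
rewrite -uE lee_fin in u0; rewrite -uE poweR_EFin -EFinD -EFinM.
apply/lee_addgt0Pr => eps eps0; rewrite -EFinD.
(* The slack is divided by [(3 * A) ^ p] so that it becomes exactly [eps] at the end. It also makes
   [v < t], so some [c] has [U c < t]. *)
pose s := v `^ p + j + eps / (3 * A) `^ p.
have vps : v `^ p + j < s by rewrite ltrDl divr_gt0.
have s0 : 0 < s by rewrite (le_lt_trans _ vps)// addr_ge0// powR_ge0.
pose t := s `^ p^-1.
have t0 : 0 < t by rewrite powR_gt0.
have tp : t `^ p = s by rewrite -powRrM mulVf ?gt_eqF// powRr1// ltW.
have vt : v < t.
  rewrite ltNge; apply/negP => tv.
  have : t `^ p <= v `^ p by apply: ge0_ler_powR; rewrite ?nnegrE//; exact: ltW.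
  rewrite tp; lra.
have [|_ [c _ <-] Uct] := @ereal_inf_lt _ [set U c | c in [set: R]] t%:E.
  by rewrite -/u -uE lte_fin.
have tj : t `^ (1 - p) * j <= t.
  apply: (@le_trans _ _ (t `^ (1 - p) * t `^ p)).
    rewrite ler_wpM2l ?powR_ge0// tp; have := powR_ge0 v p.
    by move: vps; lra.
  rewrite -powRD; last by rewrite (gt_eqF t0) implybT.
  by rewrite subrK powRr1// ltW.
have et : (e <= (3 * A * t)%:E)%E.
  apply: (le_trans (H c t t0)); rewrite -EFinM.
  apply: (@le_trans _ _ (A%:E * t%:E + t%:E + (t * A)%:E)%E).
    rewrite leeD2r// leeD ?lee_fin//; apply: lee_wpmul2l; last exact: ltW.
    by rewrite lee_fin ltW.
  rewrite -EFinM -!EFinD lee_fin; have : t <= A * t by rewrite ler_peMl// ltW.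
  lra.
apply: (@le_trans _ _ ((3 * A * t)%:E `^ p)%E).
  apply: gt0_ler_poweR => //; first exact: ltW.
    by rewrite in_itv/= e0 leey.
  by rewrite in_itv/= leey andbT (le_trans e0).
rewrite poweR_EFin lee_fin powRM; [|by rewrite mulr_ge0// ltW|exact: ltW].
rewrite tp /s mulrDr lerD2l.
by rewrite mulrCA divff ?mulr1// gt_eqF.
Qed.

End Young.

Section Averages.
Context {R : realType} {d0 : measure_display} {X : measurableType d0}.
Variables (N : nat) (nu : 'I_N -> {measure set X -> \bar R}) (B : set X).
Variables (F : 'I_N -> X -> R) (a : 'I_N -> R) (i : 'I_N) (M p : R).
Hypotheses (mB : measurable B) (mF : forall j, measurable_fun setT (F j)).
Hypotheses (nufin : forall j, (nu j B < +oo)%E) (nui : (0 < nu i B)%E).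
Hypotheses (a0 : forall j, 0 < a j) (M0 : 0 <= M) (p1 : 1 < p).
Let n j := fine (nu j B).
Hypothesis aM : forall j, a j * n j <= M * (a i * n i).

Let w := fine (\sum_(j < N) (a j)%:E * nu j B)%E.

Let nE j : nu j B = (n j)%:E.
Proof. by rewrite /n fineK// ge0_fin_numE. Qed.

Let n_ge0 j : 0 <= n j. Proof. exact: fine_ge0. Qed.

Let ni0 : 0 < n i. Proof. by move: nui; rewrite nE lte_fin. Qed.

Let b0 : 0 < a i * n i. Proof. exact: mulr_gt0. Qed.

Let wE : w = \sum_(j < N) a j * n j.
Proof. by rewrite /w; under eq_bigr do rewrite nE -EFinM; rewrite sumEFin. Qed.

Let bw : a i * n i <= w.
Proof.
rewrite wE (bigD1 i)//= lerDl sumr_ge0// => j _; by rewrite mulr_ge0// ltW.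
Qed.

(** The total mass [w] is at least the [i]-th weighted mass, so dividing by the latter only
    increases the average. *)
Let w_le (T : 'I_N -> \bar R) : (forall j, 0 <= T j)%E ->
  ((w^-1)%:E * (\sum_(j < N) (a j)%:E * T j) <=
   \sum_(j < N) (a j / (a i * n i))%:E * T j)%E.
Proof.
move=> T0.
have aT0 j : (0 <= (a j)%:E * T j)%E by rewrite mule_ge0// lee_fin ltW.
apply: (@le_trans _ _ (((a i * n i)^-1)%:E * (\sum_(j < N) (a j)%:E * T j))%E).
  apply: lee_wpmul2r; first exact: sume_ge0.
  by rewrite lee_fin lef_pV2// posrE// (lt_le_trans b0).
rewrite ge0_sume_distrr//; apply: lee_sum => j _.
by rewrite muleA -EFinM mulrC.
Qed.

Let mabs c j : measurable_fun B (fun z => (`|F j z - c|)%:E).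
Proof.
apply/measurable_EFinP; apply: measurableT_comp => //; apply: measurable_funB => //.
exact: measurable_funS (mF j).
Qed.

Let mpow c j : measurable_fun B (fun z => (`|c - F j z| `^ p)%:E).
Proof.
apply/measurable_EFinP; apply: (measurableT_comp (measurable_powR p)).
apply: measurableT_comp => //; apply: measurable_funB => //.
exact: measurable_funS (mF j).
Qed.

(** Start from [|F j z - c| <= |F i y - F j z| + |F i y - c|], apply [ler_young] to the first
    summand, and integrate in [z], then in [y]. *)
Let split_integral j c lam : 0 < lam ->
  ((n i)%:E * \int[nu j]_(z in B) (`|F j z - c|)%:E <=
   (lam `^ (1 - p))%:E * \int[nu i]_(y in B) \int[nu j]_(z in B)
       (`|F i y - F j z| `^ p)%:E
   + (lam * n i * n j)%:E
   + (n j)%:E * \int[nu i]_(y in B) (`|F i y - c|)%:E)%E.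
Proof.
move=> lam0; set C0 := lam `^ (1 - p).
have C00 : 0 < C0 by rewrite powR_gt0.
have Ij y : (\int[nu j]_(z in B) (`|F j z - c|)%:E <=
    C0%:E * \int[nu j]_(z in B) (`|F i y - F j z| `^ p)%:E
      + ((lam + `|F i y - c|) * n j)%:E)%E.
  apply: (@le_trans _ _ (\int[nu j]_(z in B)
      (C0%:E * (`|F i y - F j z| `^ p)%:E + (lam + `|F i y - c|)%:E))%E).
    apply: ge0_le_integralS => // z Bz.
      by rewrite adde_ge0 ?mule_ge0// lee_fin ?addr_ge0 ?powR_ge0// ltW.
    rewrite -EFinM -EFinD lee_fin addrA.
    apply: (@le_trans _ _ (`|F i y - F j z| + `|F i y - c|)).
      by rewrite (distrC (F i y) (F j z)) (le_trans _ (ler_normD _ _))// addrA subrK.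
    by rewrite lerD2r ler_young.
  rewrite ge0_integralD//; last 3 first.
  - by move=> z _; rewrite -EFinM lee_fin mulr_ge0 ?powR_ge0.
  - by apply: emeasurable_funM => //; exact: mpow.
  - by move=> z _; rewrite lee_fin addr_ge0// ltW.
  rewrite ge0_integralZl//; last by rewrite lee_fin ltW.
  by rewrite integral_cst// nE -EFinM.
(* The affine bound multiplies both summands by [C0], so the second one is divided by it beforehand.
   The inner pair integral enters as the summand of unknown measurability. *)
pose g y := ((C0^-1 * ((lam + `|F i y - c|) * n j))%:E : \bar R).
have g0 y : (0 <= g y)%E.
  by rewrite lee_fin !mulr_ge0 ?invr_ge0 ?addr_ge0// ltW.
have mg : measurable_fun B g.
  apply/measurable_EFinP; apply: measurable_funM => //; apply: measurable_funM => //.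
  by apply: measurable_funD => //; apply/measurable_EFinP; exact: mabs.
have gE y : g y = ((C0^-1 * lam * n j)%:E + (C0^-1 * n j)%:E * (`|F i y - c|)%:E)%E.
  by rewrite /g -EFinM -EFinD; congr EFin; ring.
have := @ge0_integral_le_affine _ _ _ (nu i) B C0
  (fun=> \int[nu j]_(z in B) (`|F j z - c|)%:E)%E
  (fun y => \int[nu j]_(z in B) (`|F i y - F j z| `^ p)%:E)%E g mB C00.
have h0 y : (0 <= \int[nu j]_(z in B) (`|F i y - F j z| `^ p)%:E)%E.
  by apply: integral_ge0 => z _; rewrite lee_fin powR_ge0.
have e0 : (0 <= \int[nu j]_(z in B) (`|F j z - c|)%:E)%E by exact: integral_ge0.
rewrite integral_cst// nE muleC.
move=> /(_ (fun y _ => e0) (fun y _ => h0 y) (fun y _ => g0 y) mg) H.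
apply: (le_trans (H _)).
  move=> y _; apply: (le_trans (Ij y)); rewrite [leRHS]ge0_muleDr//.
  by rewrite leeD2l// /g -EFinM mulrA divff ?mul1r// gt_eqF.
rewrite ge0_muleDr; last 2 first.
- apply: integral_ge0 => y _; apply: integral_ge0 => z _; by rewrite lee_fin powR_ge0.
- exact: integral_ge0.
rewrite -addeA leeD2l//.
under eq_integral do rewrite gE.
rewrite ge0_integralD//; last 3 first.
- by move=> y _; rewrite lee_fin !mulr_ge0 ?invr_ge0// ltW.
- by move=> y _; rewrite -EFinM lee_fin !mulr_ge0 ?invr_ge0// ltW.
- by apply: emeasurable_funM => //; exact: mabs.
rewrite integral_cst// nE ge0_integralZl//; last first.
  by rewrite lee_fin mulr_ge0 ?invr_ge0// ltW.
rewrite ge0_muleDr; last 2 first.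
- by rewrite -EFinM lee_fin !mulr_ge0 ?invr_ge0// ltW.
- by rewrite mule_ge0 ?integral_ge0// lee_fin mulr_ge0 ?invr_ge0// ltW.
rewrite muleA -!EFinM leeD//.
  by rewrite lee_fin le_eqVlt; apply/orP; left; apply/eqP; field; rewrite gt_eqF.
by rewrite muleA -EFinM mulrA divff ?mul1r// gt_eqF.
Qed.

(** The term [j = i] is the average [V] itself. Each other term is transferred to [nu i] by
    [split_integral], and [aM] keeps the resulting coefficients of [V] and [lam] below [M]. *)
Lemma average_le_pairs c lam : 0 < lam ->
  ((w^-1)%:E * (\sum_(j < N) (a j)%:E * \int[nu j]_(z in B) (`|F j z - c|)%:E) <=
   (1 + N%:R * M)%:E * (((n i)^-1)%:E * \int[nu i]_(z in B) (`|F i z - c|)%:E)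
   + (lam `^ (1 - p))%:E * (\sum_(j < N | j != i) (a j / (a i * n i ^+ 2))%:E *
       \int[nu i]_(y in B) \int[nu j]_(z in B) (`|F i y - F j z| `^ p)%:E)
   + (lam * (1 + N%:R * M))%:E)%E.
Proof.
move=> lam0; set V := (((n i)^-1)%:E * _)%E.
have V0 : (0 <= V)%E by rewrite mule_ge0 ?integral_ge0// lee_fin invr_ge0.
pose D j := (\int[nu i]_(y in B) \int[nu j]_(z in B) (`|F i y - F j z| `^ p)%:E)%E.
have D0 j : (0 <= D j)%E.
  by apply: integral_ge0 => y _; apply: integral_ge0 => z _; rewrite lee_fin powR_ge0.
apply: (le_trans (w_le _)); first by move=> j; exact: integral_ge0.
rewrite (bigD1 i)//=.
have -> : a i / (a i * n i) = (n i)^-1.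
  by field; rewrite !gt_eqF.
rewrite -/V.
(* The second factor [n i] in the denominator averages over the auxiliary point [y]; [aM] says
   precisely that [c0 j * n i * n j <= M]. *)
pose c0 j := a j / (a i * n i ^+ 2).
have c00 j : 0 <= c0 j by rewrite divr_ge0 ?mulr_ge0 ?exprn_ge0// ltW.
have step j : j != i -> ((a j / (a i * n i))%:E *
    \int[nu j]_(z in B) (`|F j z - c|)%:E <=
    M%:E * V + (lam `^ (1 - p))%:E * ((c0 j)%:E * D j) + (lam * M)%:E)%E.
  move=> ji.
  have -> : a j / (a i * n i) = c0 j * n i.
    by rewrite /c0; field; rewrite !gt_eqF.
  rewrite EFinM -muleA.
  apply: (@le_trans _ _ ((c0 j)%:E * ((lam `^ (1 - p))%:E * D j
   + (lam * n i * n j)%:E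
   + (n j)%:E * \int[nu i]_(y in B) (`|F i y - c|)%:E))%E).
    by apply: lee_wpmul2l; [rewrite lee_fin|exact: split_integral].
  have E1 : (0 <= (lam `^ (1 - p))%:E * D j)%E.
    by rewrite mule_ge0// lee_fin powR_ge0.
  have E2 : (0 <= (lam * n i * n j)%:E)%E.
    by rewrite lee_fin !mulr_ge0// ltW.
  have E3 : (0 <= (n j)%:E * \int[nu i]_(y in B) (`|F i y - c|)%:E)%E.
    by rewrite mule_ge0 ?integral_ge0// lee_fin.
  rewrite ge0_muleDr ?adde_ge0// ge0_muleDr// addeC addeA.
  have cnM : c0 j * n i * n j <= M.
    rewrite /c0 (_ : _ * n j = a j * n j / (a i * n i)); last first.
      by field; rewrite !gt_eqF.
    by rewrite ler_pdivrMr.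
  apply: leeD.
    apply: leeD; last by rewrite muleCA.
    have -> : (\int[nu i]_(y in B) (`|F i y - c|)%:E = (n i)%:E * V)%E.
      by rewrite /V muleA -EFinM divff ?mul1e// gt_eqF.
    rewrite (muleA (n j)%:E) (muleA (c0 j)%:E) -!EFinM.
    apply: lee_wpmul2r => //; by rewrite lee_fin mulrA mulrAC.
  rewrite -EFinM lee_fin.
  have -> : c0 j * (lam * n i * n j) = lam * (c0 j * n i * n j) by ring.
  by rewrite ler_pM2l.
apply: (@le_trans _ _ (V + \sum_(j < N | j != i)
   (M%:E * V + (lam `^ (1 - p))%:E * ((c0 j)%:E * D j) + (lam * M)%:E))%E).
  by rewrite leeD2l//; apply: lee_sum => j; exact: step.
rewrite !big_split/= [X in (_ <= _ + X + _)%E]ge0_sume_distrr; last first.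
  by move=> j _; apply: mule_ge0; [rewrite lee_fin; exact: (c00 j)|exact: D0].
have cst_le (x : \bar R) : (0 <= x)%E ->
    (\sum_(j < N | j != i) x <= N%:R%:E * x)%E.
  move=> x0; apply: (@le_trans _ _ (\sum_(j < N) x)%E).
    by rewrite [leRHS](bigD1 i)//= leeDr.
  by rewrite sume_const_ord.
rewrite !addeA; apply: leeD; last first.
  apply: (le_trans (cst_le _ _)); first by rewrite lee_fin mulr_ge0// ltW.
  by rewrite -EFinM lee_fin mulrDr mulr1 mulrCA ler_wpDl// ltW.
apply: leeD => //.
rewrite EFinD ge0_muleDl ?lee_fin ?mulr_ge0// mul1e leeD2l//.
by rewrite EFinM -muleA; apply: cst_le; rewrite mule_ge0// lee_fin.
Qed.

(** Here [c = 0], and [ler_young] is applied to [|F j z|] directly, so [L_p] norms replace the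
    comparison of pairs. *)
Lemma average_le_power lam : 0 < lam ->
  ((w^-1)%:E * (\sum_(j < N) (a j)%:E * \int[nu j]_(z in B) (`|F j z|)%:E) <=
   (lam `^ (1 - p))%:E * (\sum_(j < N) (a j / (a i * n i))%:E *
       \int[nu j]_(z in B) (`|F j z| `^ p)%:E)
   + (lam * (1 + N%:R * M))%:E)%E.
Proof.
move=> lam0; apply: (le_trans (w_le _)); first by move=> j; exact: integral_ge0.
have C0 : 0 < lam `^ (1 - p) by rewrite powR_gt0.
have ab0 j : 0 <= a j / (a i * n i) by rewrite divr_ge0 ?ltW.
have D0 j : (0 <= \int[nu j]_(z in B) (`|F j z| `^ p)%:E)%E.
  by apply: integral_ge0 => z _; rewrite lee_fin powR_ge0.
have step j : ((a j / (a i * n i))%:E * \int[nu j]_(z in B) (`|F j z|)%:E <=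
   (lam `^ (1 - p))%:E * ((a j / (a i * n i))%:E *
       \int[nu j]_(z in B) (`|F j z| `^ p)%:E) + (lam * M)%:E)%E.
  have mp : measurable_fun B (fun z => (`|F j z| `^ p)%:E).
    by under eq_fun do rewrite -normrN -sub0r; exact: mpow.
  apply: (@le_trans _ _ ((a j / (a i * n i))%:E *
    ((lam `^ (1 - p))%:E * \int[nu j]_(z in B) (`|F j z| `^ p)%:E
     + (lam * n j)%:E))%E).
    apply: lee_wpmul2l; first by rewrite lee_fin.
    apply: (@le_trans _ _ (\int[nu j]_(z in B)
       ((lam `^ (1 - p))%:E * (`|F j z| `^ p)%:E + lam%:E))%E).
      apply: ge0_le_integralS => // z Bz.
        by rewrite -EFinM -EFinD lee_fin addr_ge0 ?mulr_ge0 ?powR_ge0// ltW.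
      by rewrite -EFinM -EFinD lee_fin ler_young.
    rewrite ge0_integralD//; last 3 first.
    - by move=> z _; rewrite -EFinM lee_fin mulr_ge0 ?powR_ge0.
    - exact: emeasurable_funM.
    - by move=> z _; rewrite lee_fin ltW.
    rewrite ge0_integralZl//; last by rewrite lee_fin ltW.
    by rewrite integral_cst// nE -EFinM.
  rewrite ge0_muleDr; last 2 first.
  - by rewrite mule_ge0// lee_fin ltW.
  - by rewrite lee_fin mulr_ge0// ltW.
  apply: leeD; first by rewrite muleCA.
  rewrite -EFinM lee_fin mulrCA ler_pM2l// mulrAC ler_pdivrMr//.
apply: (le_trans (lee_sum _ (fun j _ => step j))).
rewrite big_split/= -ge0_sume_distrr; last by move=> j _; rewrite mule_ge0 ?lee_fin.
rewrite leeD2l// sume_const_ord; last by rewrite lee_fin mulr_ge0// ltW.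
by rewrite -EFinM lee_fin mulrDr mulr1 mulrCA ler_wpDl// ltW.
Qed.

End Averages.

(** * Integrals of ball averages *)

Section BallAverages.
Context {R : realType} {d0 : measure_display} {X : measurableType d0}.
Variables (dist : X -> X -> R) (mu : {sigma_finite_measure set X -> \bar R}).
Hypotheses (dm : is_metric dist) (dsep : dseparable dist)
  (dbor : borel_sets dist).

Lemma measurable_measure_cball r :
  measurable_fun setT (fun x => mu (cball dist x r)).
Proof.
have := measurable_fun_xsection mu (measurable_dist_le dm dsep dbor r).
congr measurable_fun; apply/funext => x /=; congr (mu _).
by rewrite xsectionE.
Qed.

Let m r x := fine (mu (cball dist x r)).

Lemma measurable_fine_measure_cball r : measurable_fun setT (m r).
Proof.
exact: (measurableT_comp (fine_measurable measurableT) (measurable_measure_cball r)).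
Qed.

Lemma measurable_inv_measure_cball r : measurable_fun setT (fun x => (m r x)^-1).
Proof.
under eq_fun => x do rewrite -(powR_inv1 (fine_ge0 (measure_ge0 mu _))).
exact: (measurableT_comp (measurable_powR (-1)) (measurable_fine_measure_cball r)).
Qed.

Section Swap.
Variables (nu nu' : {sigma_finite_measure set X -> \bar R}) (r : R) (h : X -> \bar R).
Hypotheses (h0 : forall x, (0 <= h x)%E) (mh : measurable_fun setT h).

(** Integrating this kernel in the second variable gives the ball average of [h]; integrating in the
    first leaves [h] times the integral bounded by [HK]. *)
Let G (z : X * X) : \bar R :=
  (((m r z.1)^-1)%:E * ((\1_[set z : X * X | dist z.1 z.2 <= r] z)%:E * h z.2))%E.

Let G0 z : (0 <= G z)%E.
Proof. by rewrite mule_ge0 ?mule_ge0 ?lee_fin ?invr_ge0 ?fine_ge0. Qed.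

Let mG : measurable_fun setT G.
Proof.
apply: emeasurable_funM.
  apply/measurable_EFinP.
  exact: (measurableT_comp (measurable_inv_measure_cball r) measurable_fst).
apply: emeasurable_funM; last exact: measurableT_comp mh measurable_snd.
apply/measurable_EFinP; apply: measurable_indic; exact: measurable_dist_le.
Qed.

Let mem_dist_le x y :
  ((x, y) \in [set z : X * X | dist z.1 z.2 <= r]) = (y \in cball dist x r).
Proof. by apply/idP/idP => /set_mem xy; exact: mem_set. Qed.

Let GE x : (\int[nu']_y G (x, y))%E =
  (((m r x)^-1)%:E * \int[nu']_(y in cball dist x r) h y)%E.
Proof.
rewrite /G/= ge0_integralZl//; last 3 first.
- apply: emeasurable_funM => //; apply/measurable_EFinP.
  rewrite (_ : (fun y => _) = \1_(cball dist x r) :> (X -> R)).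
    by apply: measurable_indic; exact: measurable_cball.
  by apply/funext => y; rewrite !indicE mem_dist_le.
- by move=> y _; rewrite mule_ge0// lee_fin.
- by rewrite lee_fin invr_ge0 fine_ge0.
congr (_ * _)%E; rewrite [RHS]integral_mkcond; apply: eq_integral => y _.
rewrite indicE patchE.
rewrite mem_dist_le.
by case: ifP; rewrite ?mul1e ?mul0e.
Qed.

Lemma measurable_ball_average : measurable_fun setT
  (fun x => ((m r x)^-1)%:E * \int[nu']_(y in cball dist x r) h y)%E.
Proof.
under eq_fun do rewrite -GE; exact: measurable_fun_fubini_tonelli_F.
Qed.

(** Tonelli exchanges the integrals; by symmetry of [dist], the centres [x] whose ball contains [y]
    form [cball y r]. *)
Lemma integral_ball_average_le (K : R) : 0 <= K ->
  (forall y, \int[nu]_(x in cball dist y r) ((m r x)^-1)%:E <= K%:E)%E ->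
  (\int[nu]_x (((m r x)^-1)%:E * \int[nu']_(y in cball dist x r) h y) <=
   K%:E * \int[nu']_y h y)%E.
Proof.
have [_ _ dC _] := dm.
move=> K0 HK; under eq_integral do rewrite -GE.
rewrite (fubini_tonelli _ mG G0) -ge0_integralZl//.
apply: ge0_le_integralS => //.
- by move=> y _; exact: integral_ge0.
- by move=> y _; rewrite mule_ge0.
move=> y _; rewrite muleC; apply: le_trans (lee_wpmul2l (h0 y) (HK y)).
rewrite [X in (_ <= _ * X)%E]integral_mkcond -ge0_integralZl//; last 2 first.
- apply/(measurable_restrictT _ _).1; first exact: measurable_cball.
  apply/measurable_EFinP; apply: measurable_funS (measurable_inv_measure_cball r) => //.
- by move=> x _; rewrite erestrict_ge0// => z _; rewrite lee_fin invr_ge0 fine_ge0.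
rewrite le_eqVlt; apply/orP; left; apply/eqP; apply: eq_integral => x _.
rewrite /G indicE patchE.
have -> : ((x, y) \in [set z : X * X | dist z.1 z.2 <= r]) = (x \in cball dist y r).
  rewrite mem_dist_le; apply/idP/idP => /set_mem; rewrite /cball/= dC => xy;
    exact: mem_set.
by case: ifP => _ /=; rewrite ?mul1e ?mul0e ?mule0// muleC.
Qed.

End Swap.
End BallAverages.

(** * Estimates at one scale *)

Section Level.
Context {R : realType} {d0 : measure_display} {X : measurableType d0}.
Variables (dist : X -> X -> R) (mu : {sigma_finite_measure set X -> \bar R}).
Hypotheses (dm : is_metric dist) (dsep : dseparable dist)
  (dbor : borel_sets dist).
Variables (N : nat) (p : R) (th : 'I_N -> R) (S : 'I_N -> set X)
  (nu : 'I_N -> {sigma_finite_measure set X -> \bar R}) (F : 'I_N -> X -> R).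
Hypotheses (p1 : 1 < p) (mS : forall i, measurable (S i))
  (mF : forall i, measurable_fun setT (F i)).
Hypotheses (mu_fin : forall x r, (mu (cball dist x r) < +oo)%E)
  (mu_pos : forall x r, 0 < r -> (0 < mu (cball dist x r))%E).
Variables (C k1 K : R).
Hypotheses (C1 : 1 <= C) (k10 : 0 < k1) (K0 : 0 < K).
Hypothesis (HC : forall x y r, 0 < r <= 1 -> dist x y <= 2 * r ->
    (mu (cball dist y (2 * r)) <= C%:E * mu (cball dist x r))%E).
Hypothesis (Hlow : forall i x r, S i x -> 0 < r <= 1 ->
    ((k1 * r `^ (- th i))%:E * mu (cball dist x r) <= nu i (cball dist x r))%E).
Hypothesis (Hup : forall i x r, 0 < r <= 2^-1 ->
    (nu i (cball dist x r) <= (K * r `^ (- th i))%:E * mu (cball dist x r))%E).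
Variables (r q : R) (a : 'I_N -> R).
Hypotheses (r2 : 0 < r <= 2^-1) (q0 : 0 < q) (aq : forall j, a j = q * r `^ th j).

Let m t x := fine (mu (cball dist x t)).
Let A := 1 + N%:R * (K / k1).

Let C0 : 0 < C. Proof. by rewrite (lt_le_trans ltr01). Qed.

Let r0 : 0 < r. Proof. by case/andP : r2. Qed.

Let r1 : 0 < r <= 1. Proof. by case/andP : r2 => ? ?; apply/andP; split; lra. Qed.

Let rth t : 0 < r `^ t. Proof. exact: powR_gt0. Qed.

Let mE t x : mu (cball dist x t) = (m t x)%:E.
Proof. by rewrite fineK// ge0_fin_numE. Qed.

Let m_gt0 t x : 0 < t -> 0 < m t x.
Proof. by move=> t0; rewrite -lte_fin -mE mu_pos. Qed.

Let m_double x y t : 0 < t <= 1 -> dist x y <= 2 * t -> m (2 * t) y <= C * m t x.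
Proof. by move=> t1 xy; rewrite -lee_fin EFinM -!mE HC. Qed.

Let m_near x y : dist x y <= r -> m r y <= C * m r x.
Proof.
move=> xy; apply: (@le_trans _ _ (m (2 * r) y)).
  rewrite -lee_fin -!mE; apply: le_measure; rewrite ?inE; [exact: measurable_cball..|].
  by move=> z /=; rewrite /cball/=; have := r0; lra.
by apply: m_double => //; have := r0; move: xy; lra.
Qed.

Let n i x := fine (nu i (cball dist x r)).

Let nu_fin i x : (nu i (cball dist x r) < +oo)%E.
Proof. by apply: (le_lt_trans (Hup i x r2)); rewrite mE -EFinM ltry. Qed.

Let nE i x : nu i (cball dist x r) = (n i x)%:E.
Proof. by rewrite fineK// ge0_fin_numE. Qed.

Let n_up i x : n i x <= K * r `^ (- th i) * m r x.
Proof. by rewrite -lee_fin EFinM -mE -nE Hup. Qed.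

Let n_low i x : S i x -> k1 * r `^ (- th i) * m r x <= n i x.
Proof. by move=> Sx; rewrite -lee_fin EFinM -mE -nE Hlow. Qed.

Let n_gt0 i x : S i x -> 0 < n i x.
Proof.
by move=> Sx; apply: lt_le_trans (n_low Sx); rewrite !mulr_gt0// m_gt0.
Qed.

Let a0 j : 0 < a j. Proof. by rewrite aq mulr_gt0. Qed.

Let KM0 : 0 <= K / k1. Proof. by rewrite divr_ge0// ltW. Qed.

Let A1 : 1 <= A. Proof. by rewrite lerDl mulr_ge0. Qed.

(** The power [r ^ th i] in [a i] cancels the [r ^ (- th i)] of regularity. So the weighted masses
    of all the pieces are comparable with the same quantity [q * m r x], which yields [anM]. *)
Let an_low i x : S i x -> k1 * q * m r x <= a i * n i x.
Proof.
move=> Sx; apply: (@le_trans _ _ (a i * (k1 * r `^ (- th i) * m r x))).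
  rewrite aq powRN le_eqVlt; apply/orP; left; apply/eqP.
  by field; rewrite gt_eqF.
by rewrite ler_pM2l// n_low.
Qed.

Let an_up j x : a j * n j x <= K * q * m r x.
Proof.
apply: (@le_trans _ _ (a j * (K * r `^ (- th j) * m r x))).
  by rewrite ler_pM2l// n_up.
rewrite aq powRN le_eqVlt; apply/orP; left; apply/eqP.
by field; rewrite gt_eqF.
Qed.

Let anM i x : S i x -> forall j, a j * n j x <= K / k1 * (a i * n i x).
Proof.
move=> Sx j; apply: (le_trans (an_up j x)).
apply: (@le_trans _ _ (K / k1 * (k1 * q * m r x))).
  by rewrite le_eqVlt; apply/orP; left; apply/eqP; field; rewrite gt_eqF.
by rewrite ler_wpM2l// an_low.
Qed.

Let nu_low i x : S i x -> (0 < nu i (cball dist x r))%E.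
Proof. by move=> Sx; rewrite nE lte_fin n_gt0. Qed.

(** On [cball y r] doubling gives [1 / m r x <= C / m r y], and regularity bounds the mass of that
    ball by [K * r ^ (- th i) * m r y]. *)
Lemma integral_inv_measure_le i y :
  (\int[nu i]_(x in cball dist y r) ((m r x)^-1)%:E <= (C * K * r `^ (- th i))%:E)%E.
Proof.
have [_ _ dC _] := dm.
apply: (@le_trans _ _ (\int[nu i]_(x in cball dist y r) (C / m r y)%:E)%E).
  apply: ge0_le_integralS => // x xy; rewrite lee_fin.
  - by rewrite invr_ge0 fine_ge0.
  - by rewrite divr_ge0 ?fine_ge0// ltW.
  rewrite ler_pdivlMr ?m_gt0// mulrC ler_pdivrMr ?m_gt0//.
  by apply: m_near; rewrite dC.
rewrite integral_cst; last exact: measurable_cball.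
rewrite [X in (_ * X <= _)%E](nE i y) -EFinM lee_fin mulrAC ler_pdivrMr ?m_gt0// -!mulrA ler_pM2l//.
by rewrite mulrA n_up.
Qed.

Let wgt y z := (m (2 * r) y * m (2 * r) z) `^ (- 2^-1).

(** Two points of one ball of radius [r] are at distance at most [2 * r]. For [r = 2 ^- k.+1] this
    is the inner integral of the gluing functional at scale [k]. *)
Definition pair_energy i j y : \bar R :=
  (\int[nu j]_z (if (dist y z <= 2 * r)%R
      then (wgt y z * `|F i y - F j z| `^ p)%:E else 0))%E.

Let pair_energy_kernel i j (z : X * X) : \bar R :=
  (\1_[set z : X * X | dist z.1 z.2 <= 2 * r] z
    * (wgt z.1 z.2 * `|F i z.1 - F j z.2| `^ p))%:E.

Let pair_energyE i j y :
  pair_energy i j y = (\int[nu j]_z pair_energy_kernel i j (y, z))%E.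
Proof.
apply: eq_integral => z _; rewrite /pair_energy_kernel indicE/=.
case: ifPn => yz; first by rewrite mem_set ?mul1r.
by rewrite memNset ?mul0r//=; exact/negP.
Qed.

Let mkernel i j : measurable_fun setT (pair_energy_kernel i j).
Proof.
apply/measurable_EFinP; apply: measurable_funM.
  by apply: measurable_indic; exact: measurable_dist_le.
apply: measurable_funM.
  apply: (measurableT_comp (measurable_powR _)); apply: measurable_funM.
    exact: (measurableT_comp (measurable_fine_measure_cball mu dm dsep dbor _) measurable_fst).
  exact: (measurableT_comp (measurable_fine_measure_cball mu dm dsep dbor _) measurable_snd).
apply: (measurableT_comp (measurable_powR _)); apply: measurableT_comp => //.
apply: measurable_funB.
  exact: measurableT_comp (mF i) measurable_fst.
exact: measurableT_comp (mF j) measurable_snd.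
Qed.

Let kernel0 i j z : (0 <= pair_energy_kernel i j z)%E.
Proof. by rewrite lee_fin !mulr_ge0 ?powR_ge0. Qed.

Lemma pair_energy_ge0 i j y : (0 <= pair_energy i j y)%E.
Proof. by rewrite pair_energyE integral_ge0. Qed.

Lemma measurable_pair_energy i j : measurable_fun setT (pair_energy i j).
Proof.
rewrite (_ : pair_energy i j = fubini_F (nu j) (pair_energy_kernel i j)).
  exact: measurable_fun_fubini_tonelli_F.
by apply/funext => y; rewrite pair_energyE.
Qed.

(** The oscillation of [F i] for [nu i], without the positivity test of [AvE], which succeeds at
    points of [S i]. *)
Definition osc i x : \bar R :=
  ereal_inf [set ((n i x)^-1)%:E * \int[nu i]_(z in cball dist x r) (`|F i z - c|)%:E
     | c in [set: R]]%E.

(** The normalisation is by the [mu]-mass of the ball, not the [nu']-mass; the powers of [r]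
    relating the two stay outside. *)
Let avg nu' (h : X -> \bar R) x :=
  (((m r x)^-1)%:E * \int[nu']_(y in cball dist x r) h y)%E.

Let w x := fine (\sum_(j < N) (a j)%:E * nu j (cball dist x r))%E.

(** For [y] and [z] in [cball x r], doubling bounds both [m (2 * r) y] and [m (2 * r) z] by
    [C * m r x], so [wgt y z * (C * m r x) >= 1]. The domain of [z] is then enlarged to the whole
    space. *)
Let pairs_le i j x :
  (\int[nu i]_(y in cball dist x r) \int[nu j]_(z in cball dist x r)
      (`|F i y - F j z| `^ p)%:E <=
   (C * m r x)%:E * \int[nu i]_(y in cball dist x r) pair_energy i j y)%E.
Proof.
have [_ _ dC dT] := dm.
have Cm0 : 0 < C * m r x by rewrite mulr_gt0// m_gt0.
have mB : measurable (cball dist x r) by exact: measurable_cball.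
rewrite -ge0_integralZl//; last 3 first.
- exact: measurable_funS (measurable_pair_energy i j).
- by move=> y _; exact: pair_energy_ge0.
- by rewrite lee_fin ltW.
have P0 y z : (0 <= (`|F i y - F j z| `^ p)%:E)%E by rewrite lee_fin powR_ge0.
apply: ge0_le_integralS => // y xy.
- exact: integral_ge0.
- by rewrite mule_ge0 ?pair_energy_ge0// lee_fin ltW.
have mk : measurable_fun setT (fun z => pair_energy_kernel i j (y, z)).
  apply: (measurableT_comp (mkernel i j)); exact: pair1_measurable.
rewrite pair_energyE -ge0_integralZl//; last by rewrite lee_fin ltW.
apply: ge0_le_integralS => // z.
  by move=> _; rewrite mule_ge0// lee_fin ltW.
move=> xz; rewrite /pair_energy_kernel indicE mem_set/=; last first.
  move: xy xz; rewrite /cball/= => xy xz; apply: (le_trans (dT y x z)).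
  by rewrite dC; move: xy xz; lra.
rewrite mul1r -EFinM lee_fin mulrA -[leLHS]mul1r ler_wpM2r ?powR_ge0//.
rewrite /wgt powRN ler_pdivlMr ?powR_gt0 ?mulr_gt0 ?m_gt0 ?mulr_gt0// mul1r.
have le2 u : dist x u <= r -> m (2 * r) u <= C * m r x.
  by move=> xu; apply: m_double => //; have := r0; lra.
apply: (@le_trans _ _ (((C * m r x) * (C * m r x)) `^ 2^-1)).
  apply: ge0_ler_powR; rewrite ?nnegrE ?invr_ge0//.
  - by rewrite mulr_ge0 ?fine_ge0.
  - by rewrite mulr_ge0// ltW.
  - by apply: ler_pM; rewrite ?fine_ge0// le2.
by rewrite -expr2 powR12_sqrt ?sqr_ge0// sqrtr_sqr ger0_norm// ltW.
Qed.

(** [average_le_pairs] holds for all [c] and [lam], which is the input of [poweR_inf_young];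
    regularity and [pairs_le] then make the pair coefficients explicit. *)
Lemma osc_pointwise i x (e : \bar R) : S i x -> (0 <= e)%E ->
  (forall c, e <= ((w x)^-1)%:E *
     (\sum_(j < N) (a j)%:E * \int[nu j]_(z in cball dist x r) (`|F j z - c|)%:E))%E ->
  (e `^ p <= ((3 * A) `^ p)%:E * (osc i x `^ p +
     \sum_(j < N | j != i) (C / k1 ^+ 2 * r `^ (th i + th j))%:E *
        avg (nu i) (pair_energy i j) x))%E.
Proof.
move=> Sx e0 He.
have mB : measurable (cball dist x r) by exact: measurable_cball.
pose cf j := a j / (a i * n i x ^+ 2).
pose D j := (\int[nu i]_(y in cball dist x r) \int[nu j]_(z in cball dist x r)
      (`|F i y - F j z| `^ p)%:E)%E.
have D0 j : (0 <= D j)%E.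
  by apply: integral_ge0 => y _; apply: integral_ge0 => z _; rewrite lee_fin powR_ge0.
have cf0 j : 0 <= cf j.
  by rewrite divr_ge0 ?mulr_ge0 ?exprn_ge0 ?fine_ge0// ltW.
apply: (@le_trans _ _ (((3 * A) `^ p)%:E * (osc i x `^ p +
     \sum_(j < N | j != i) (cf j)%:E * D j))%E).
  apply: poweR_inf_young => //.
  - by move=> c; rewrite mule_ge0 ?integral_ge0// lee_fin invr_ge0 fine_ge0.
  - by apply: sume_ge0 => j _; rewrite mule_ge0// lee_fin.
  move=> c lam lam0; apply: (le_trans (He c)).
  exact: (@average_le_pairs _ _ _ N (fun j => nu j) (cball dist x r) F a i (K / k1) p
    mB mF (fun j => nu_fin j x) (nu_low Sx) a0 KM0 p1 (anM Sx) c lam lam0).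
apply: lee_wpmul2l; first by rewrite lee_fin powR_ge0.
rewrite leeD2l//; apply: lee_sum => j _.
apply: (@le_trans _ _ ((cf j)%:E * ((C * m r x)%:E *
    \int[nu i]_(y in cball dist x r) pair_energy i j y))%E).
  by apply: lee_wpmul2l; [rewrite lee_fin|exact: pairs_le].
rewrite /avg !muleA -!EFinM; apply: lee_wpmul2r.
  by apply: integral_ge0 => y _; exact: pair_energy_ge0.
rewrite lee_fin.
have mx := m_gt0 x r0.
(* The denominator [a i * n i x ^+ 2] is bounded below as the product of [a i * n i x] and [n i x];
   [q] cancels. *)
have cfle : cf j <= r `^ th j * r `^ th i / (k1 ^+ 2 * m r x ^+ 2).
  rewrite /cf ler_pdivrMr; last by rewrite mulr_gt0// exprn_gt0// n_gt0.
  apply: (@le_trans _ _ (r `^ th j * r `^ th i / (k1 ^+ 2 * m r x ^+ 2) *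
      ((k1 * q * m r x) * (k1 * r `^ (- th i) * m r x)))).
    rewrite aq powRN le_eqVlt; apply/orP; left; apply/eqP.
    by field; rewrite !gt_eqF.
  rewrite ler_wpM2l//.
    by rewrite divr_ge0 ?mulr_ge0 ?exprn_ge0 ?powR_ge0// ltW.
  rewrite [n i x ^+ 2]expr2 [leRHS]mulrA; apply: ler_pM; [| |exact: an_low|exact: n_low].
    by rewrite !mulr_ge0// ltW.
  by rewrite !mulr_ge0 ?powR_ge0// ltW.
apply: (@le_trans _ _ (r `^ th j * r `^ th i / (k1 ^+ 2 * m r x ^+ 2) * (C * m r x))).
  by rewrite ler_wpM2r// mulr_ge0 ?ltW.
rewrite powRD; last by rewrite (gt_eqF r0) implybT.
by rewrite le_eqVlt; apply/orP; left; apply/eqP; field; rewrite !gt_eqF.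
Qed.

Lemma power_pointwise i x (e : \bar R) : S i x -> (0 <= e)%E ->
  (e <= ((w x)^-1)%:E *
     (\sum_(j < N) (a j)%:E * \int[nu j]_(z in cball dist x r) (`|F j z|)%:E))%E ->
  (e `^ p <= ((3 * A) `^ p)%:E *
     \sum_(j < N) (k1^-1 * r `^ th j)%:E *
        avg (nu j) (fun z => (`|F j z| `^ p)%:E) x)%E.
Proof.
move=> Sx e0 He.
have mB : measurable (cball dist x r) by exact: measurable_cball.
pose cf j := a j / (a i * n i x).
pose D j := (\int[nu j]_(z in cball dist x r) (`|F j z| `^ p)%:E)%E.
have D0 j : (0 <= D j)%E by apply: integral_ge0 => z _; rewrite lee_fin powR_ge0.
have cf0 j : 0 <= cf j by rewrite divr_ge0 ?mulr_ge0 ?fine_ge0// ltW.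
apply: (@le_trans _ _ (((3 * A) `^ p)%:E * \sum_(j < N) (cf j)%:E * D j)%E).
  (* With [U] identically zero the infimum disappears and only the term [J] remains. *)
  have := @poweR_inf_young R p A e (\sum_(j < N) (cf j)%:E * D j)%E
    (fun=> 0%E) p1 A1 e0.
  rewrite [X in ereal_inf X](_ : _ = [set 0%E]); last first.
    by apply/seteqP; split => [_ [c _ <-]|_ ->] //; exists 0.
  rewrite ereal_inf1 poweR0r ?gt_eqF ?(lt_trans ltr01)// add0e; apply => //.
    by apply: sume_ge0 => j _; rewrite mule_ge0// lee_fin.
  move=> _ lam lam0; rewrite mule0 add0e; apply: (le_trans He).
  exact: (@average_le_power _ _ _ N (fun j => nu j) (cball dist x r) F a i (K / k1) p
    mB mF (fun j => nu_fin j x) (nu_low Sx) a0 KM0 p1 (anM Sx) lam lam0).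
apply: lee_wpmul2l; first by rewrite lee_fin powR_ge0.
apply: lee_sum => j _; rewrite /avg muleA -EFinM; apply: lee_wpmul2r => //.
have mx := m_gt0 x r0.
rewrite lee_fin /cf ler_pdivrMr; last by rewrite mulr_gt0// n_gt0.
apply: (@le_trans _ _ (k1^-1 * r `^ th j / m r x * (k1 * q * m r x))).
  by rewrite aq le_eqVlt; apply/orP; left; apply/eqP; field; rewrite !gt_eqF.
by rewrite ler_wpM2l ?an_low// !mulr_ge0 ?invr_ge0 ?ltW.
Qed.

(** [osc] may fail to be measurable in [x], but the averaged pair energies are measurable, so
    [ge0_integral_le_affine] applies. Averaging costs [r ^ (- th i)], which reduces
    [r ^ (th i + th j)] to [r ^ th j]. *)
Lemma osc_level i (e : X -> \bar R) : (forall x, 0 <= e x)%E ->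
  (forall x, S i x -> forall c, e x <= ((w x)^-1)%:E *
     (\sum_(j < N) (a j)%:E * \int[nu j]_(z in cball dist x r) (`|F j z - c|)%:E))%E ->
  (\int[nu i]_(x in S i) (e x `^ p) <= ((3 * A) `^ p)%:E *
     (\int[nu i]_(x in S i) (osc i x `^ p) +
      \sum_(j < N | j != i) (C ^+ 2 * K / k1 ^+ 2 * r `^ th j)%:E *
        \int[nu i]_y pair_energy i j y))%E.
Proof.
move=> e0 He.
pose G j x := ((C / k1 ^+ 2 * r `^ (th i + th j))%:E *
        avg (nu i) (pair_energy i j) x)%E.
have c0 j : 0 <= C / k1 ^+ 2 * r `^ (th i + th j).
  by rewrite mulr_ge0 ?powR_ge0// divr_ge0 ?exprn_ge0// ltW.
have avg0 j x : (0 <= avg (nu i) (pair_energy i j) x)%E.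
  rewrite mule_ge0 ?integral_ge0// ?lee_fin ?invr_ge0 ?fine_ge0// => y _.
  exact: pair_energy_ge0.
have mavg j : measurable_fun setT (avg (nu i) (pair_energy i j)).
  apply: measurable_ball_average => //; first exact: pair_energy_ge0.
  exact: measurable_pair_energy.
have G0 j x : (0 <= G j x)%E by rewrite mule_ge0// lee_fin.
have mG j : measurable_fun (S i) (G j).
  by apply: measurable_funTS; exact: emeasurable_funM.
have K00 : 0 < (3 * A) `^ p.
  by rewrite powR_gt0// mulr_gt0// (lt_le_trans ltr01).
have Gs0 x : (0 <= \sum_(j < N | j != i) G j x)%E by exact: sume_ge0.
have mGs : measurable_fun (S i) (fun x => \sum_(j < N | j != i) G j x)%E.
  by under eq_fun do rewrite -big_filter; exact: emeasurable_sum.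
have Hpt x : S i x -> (e x `^ p <= ((3 * A) `^ p)%:E *
    (osc i x `^ p + \sum_(j < N | j != i) G j x))%E.
  by move=> Sx; apply: osc_pointwise => //; exact: He.
apply: (le_trans (@ge0_integral_le_affine _ _ _ (nu i) _ _ _ _ _ (mS i) K00
  (fun x _ => poweR_ge0 _ _) (fun x _ => poweR_ge0 _ _) (fun x _ => Gs0 x) mGs Hpt)).
apply: lee_wpmul2l; first by rewrite lee_fin ltW.
rewrite leeD2l//.
under eq_integral do rewrite -big_filter.
rewrite ge0_integral_sum// big_filter; apply: lee_sum => j _.
apply: (@le_trans _ _ (\int[nu i]_x G j x)%E).
  exact: ge0_le_integralS.
rewrite ge0_integralZl//; last by rewrite lee_fin.
apply: (@le_trans _ _ ((C / k1 ^+ 2 * r `^ (th i + th j))%:E *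
  ((C * K * r `^ (- th i))%:E * \int[nu i]_y pair_energy i j y))%E).
  apply: lee_wpmul2l; first by rewrite lee_fin.
  apply: integral_ball_average_le => //.
  - exact: pair_energy_ge0.
  - exact: measurable_pair_energy.
  - by rewrite !mulr_ge0 ?powR_ge0// ltW.
  - by move=> y; exact: integral_inv_measure_le.
rewrite muleA -EFinM; apply: lee_wpmul2r.
  by apply: integral_ge0 => y _; exact: pair_energy_ge0.
rewrite lee_fin powRD ?(gt_eqF r0) ?implybT// powRN.
by rewrite le_eqVlt; apply/orP; left; apply/eqP; field; rewrite !gt_eqF.
Qed.

(** [power_pointwise] is integrated over [S i], and [integral_ball_average_le] removes the ball
    averages. *)
Lemma power_level i (e : X -> \bar R) : (forall x, 0 <= e x)%E ->
  (forall x, S i x -> e x <= ((w x)^-1)%:E *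
     (\sum_(j < N) (a j)%:E * \int[nu j]_(z in cball dist x r) (`|F j z|)%:E))%E ->
  (\int[nu i]_(x in S i) (e x `^ p) <= ((3 * A) `^ p)%:E *
      \sum_(j < N) (C * K / k1 * r `^ (th j - th i))%:E *
        \int[nu j]_y (`|F j y| `^ p)%:E)%E.
Proof.
move=> e0 He.
pose h j y := (`|F j y| `^ p)%:E : \bar R.
have h0 j y : (0 <= h j y)%E by rewrite lee_fin powR_ge0.
have mh j : measurable_fun setT (h j).
  apply/measurable_EFinP; apply: (measurableT_comp (measurable_powR p)).
  exact: measurableT_comp.
pose G j x := ((k1^-1 * r `^ th j)%:E * avg (nu j) (h j) x)%E.
have c0 j : 0 <= k1^-1 * r `^ th j by rewrite mulr_ge0 ?powR_ge0// invr_ge0 ltW.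
have avg0 j x : (0 <= avg (nu j) (h j) x)%E.
  by rewrite mule_ge0 ?integral_ge0// ?lee_fin ?invr_ge0 ?fine_ge0.
have mavg j : measurable_fun setT (avg (nu j) (h j)).
  exact: measurable_ball_average.
have G0 j x : (0 <= G j x)%E by rewrite mule_ge0// lee_fin.
have mG j : measurable_fun (S i) (G j).
  by apply: measurable_funTS; exact: emeasurable_funM.
have K00 : 0 < (3 * A) `^ p.
  by rewrite powR_gt0// mulr_gt0// (lt_le_trans ltr01).
apply: (@le_trans _ _ (\int[nu i]_(x in S i) (((3 * A) `^ p)%:E * \sum_(j < N) G j x))%E).
  apply: ge0_le_integralS => //.
  - by move=> x _; exact: poweR_ge0.
  - by move=> x _; rewrite mule_ge0 ?sume_ge0// lee_fin ltW.
  - by move=> x Sx; exact: (power_pointwise Sx (e0 x) (He x Sx)).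
rewrite ge0_integralZl//; last 3 first.
- exact: emeasurable_sum.
- by move=> x _; exact: sume_ge0.
- by rewrite lee_fin ltW.
apply: lee_wpmul2l; first by rewrite lee_fin ltW.
rewrite ge0_integral_sum//; apply: lee_sum => j _.
apply: (@le_trans _ _ (\int[nu i]_x G j x)%E).
  exact: ge0_le_integralS.
rewrite ge0_integralZl//; last by rewrite lee_fin.
apply: (@le_trans _ _ ((k1^-1 * r `^ th j)%:E *
  ((C * K * r `^ (- th i))%:E * \int[nu j]_y h j y))%E).
  apply: lee_wpmul2l; first by rewrite lee_fin.
  apply: integral_ball_average_le => //.
  - by rewrite !mulr_ge0 ?powR_ge0// ltW.
  - by move=> y; exact: integral_inv_measure_le.
rewrite muleA -EFinM; apply: lee_wpmul2r; first exact: integral_ge0.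
rewrite lee_fin powRD ?(gt_eqF r0) ?implybT//.
by rewrite le_eqVlt; apply/orP; left; apply/eqP; field; rewrite !gt_eqF.
Qed.

End Level.

(** * Summation over the scales *)

(* The copy of a measure on which its sigma-finiteness is declared. *)
Section SigmaFiniteCopy.
Context {R : realType} {d0 : measure_display} {X : measurableType d0}.
Variables (nu : {measure set X -> \bar R}) (sf : sigma_finite setT nu).

Definition sfcopy of sigma_finite setT nu : set X -> \bar R := nu.
Local Notation copy := (sfcopy sf).

Let copy0 : copy set0 = 0%E. Proof. exact: measure0. Qed.

Let copy_ge0 A : (0 <= copy A)%E. Proof. exact: measure_ge0. Qed.

Let copy_additive : semi_sigma_additive copy.
Proof. exact: measure_semi_sigma_additive. Qed.

HB.instance Definition _ := isMeasure.Build _ _ _ copy copy0 copy_ge0 copy_additive.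

HB.instance Definition _ := Measure_isSigmaFinite.Build _ _ _ copy sf.

End SigmaFiniteCopy.

(** Tonelli is stated for bundled sigma-finite measures; this bundles one without changing its
    values. *)
Lemma sigma_finite_measure_of (R : realType) (d0 : measure_display)
    (X : measurableType d0) (nu : {measure set X -> \bar R}) :
  sigma_finite setT nu ->
  exists nu' : {sigma_finite_measure set X -> \bar R},
    (nu' : set X -> \bar R) = (nu : set X -> \bar R).
Proof. by move=> sf; exists (sfcopy sf). Qed.

Lemma powR_invXn (R : realType) (k : nat) (t : R) :
  (2 ^- k : R) `^ t = 2 `^ (- (k%:R * t)).
Proof. by rewrite -powR_mulrn// -powRN -powRrM mulNr. Qed.

Lemma nneseries_succ_le (R : realType) (f : nat -> \bar R) :
  (forall k, 0 <= f k)%E ->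
  (\sum_(1 <= k <oo) f k.+1 <= \sum_(1 <= k <oo) f k)%E.
Proof.
move=> f0; rewrite -(nneseries_addn 1 f0).
rewrite [leRHS](_ : _ = \sum_(0 <= k <oo) f k.+1)%E; last first.
  by apply: eq_eseriesr => k _; rewrite addn1.
by rewrite [leRHS]nneseries_recl// leeDr.
Qed.

Section Levels.
Context {R : realType} {d0 : measure_display} {X : measurableType d0}.
Variables (dist : X -> X -> R) (mu : {sigma_finite_measure set X -> \bar R}).
Hypotheses (dm : is_metric dist) (dsep : dseparable dist)
  (dbor : borel_sets dist).
Variables (N : nat) (p theta : R) (th : 'I_N -> R) (S : 'I_N -> set X)
  (nu : 'I_N -> {sigma_finite_measure set X -> \bar R}).
Hypotheses (p1 : 1 < p) (thetap : theta < p) (th0 : forall i, 0 < th i)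
  (mS : forall i, measurable (S i)).
Hypotheses (mu_fin : forall x r, (mu (cball dist x r) < +oo)%E)
  (mu_pos : forall x r, 0 < r -> (0 < mu (cball dist x r))%E).
Variables (C k1 K : R).
Hypotheses (C1 : 1 <= C) (k10 : 0 < k1) (K0 : 0 < K).
Hypothesis (HC : forall x y r, 0 < r <= 1 -> dist x y <= 2 * r ->
    (mu (cball dist y (2 * r)) <= C%:E * mu (cball dist x r))%E).
Hypothesis (Hlow : forall i x r, S i x -> 0 < r <= 1 ->
    ((k1 * r `^ (- th i))%:E * mu (cball dist x r) <= nu i (cball dist x r))%E).
Hypothesis (Hup : forall i x r, 0 < r <= 2^-1 ->
    (nu i (cball dist x r) <= (K * r `^ (- th i))%:E * mu (cball dist x r))%E).

Let a k j := coef theta th k j.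
Let B k x := cball dist x (2 ^- k).
Let cA := (3 * (1 + N%:R * (K / k1))) `^ p.

Let C0 : 0 < C. Proof. by rewrite (lt_le_trans ltr01). Qed.

Let cA0 : 0 <= cA. Proof. exact: powR_ge0. Qed.

Let a0 k j : 0 < a k j. Proof. exact: powR_gt0. Qed.

(** This puts [coef] into the shape [q * r ^ th j] of the one-scale estimates, with [r = 2 ^- k] and
    [q = 2 ^ (k * theta)]. *)
Let aq k j : a k j = 2 `^ (k%:R * theta) * (2 ^- k) `^ th j.
Proof.
rewrite powR_invXn -powRD; last by rewrite pnatr_eq0 implybT.
by rewrite /a /coef mulrBr.
Qed.

Let rk k : 0 < (2 ^- k.+1 : R) <= 2^-1.
Proof.
rewrite invr_gt0 exprn_gt0//= lef_pV2 ?posrE ?exprn_gt0//.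
by rewrite -[leLHS]expr1 ler_weXn2l// ler1n.
Qed.

(** These are the constants of [power_level] at radius [2 ^- 1]. [D1] collects them for level 1;
    [D2] serves the later levels, its [2 ^ p] paying for the passage from level [k.+1] to gluing
    scale [k]. *)
Let const1 i j : R := C * K / k1 * (2 ^- 1) `^ (th j - th i).
Let D1 : R := 2 `^ (theta - p) * \sum_(i < N) a 1 i * (cA * \sum_(j < N) const1 i j).
Let D2 : R := cA * (1 + C ^+ 2 * K / k1 ^+ 2 * 2 `^ p).

Let const1_ge0 i j : 0 <= const1 i j.
Proof. by rewrite mulr_ge0 ?powR_ge0// divr_ge0 ?mulr_ge0// ltW. Qed.

Let sum_ge0 i : 0 <= cA * \sum_(j < N) const1 i j.
Proof. by rewrite mulr_ge0// sumr_ge0. Qed.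

Let D1_ge0 : 0 <= D1.
Proof.
by rewrite mulr_ge0 ?powR_ge0// sumr_ge0// => i _; rewrite mulr_ge0// ltW.
Qed.

Let cc0 : 0 <= C ^+ 2 * K / k1 ^+ 2.
Proof. by rewrite divr_ge0 ?mulr_ge0 ?exprn_ge0// ltW. Qed.

Let D2_ge0 : 0 <= D2.
Proof. by rewrite mulr_ge0// addr_ge0// mulr_ge0// powR_ge0. Qed.

Section Fixed.
Variables (F : 'I_N -> X -> R) (e : nat -> X -> \bar R) (Y : \bar R).
Hypotheses (mF : forall i, measurable_fun setT (F i))
  (e0 : forall k x, (0 <= e k x)%E).
Hypothesis He : forall k i x c, S i x ->
  (e k.+1 x <= ((fine (\sum_(j < N) (a k.+1 j)%:E * nu j (B k.+1 x)))^-1)%:E *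
     (\sum_(j < N) (a k.+1 j)%:E * \int[nu j]_(z in B k.+1 x) (`|F j z - c|)%:E))%E.

Let L i := (\int[nu i]_y (`|F i y| `^ p)%:E)%E.
Let Q i k := ((2 `^ (k%:R * (p - th i)))%:E *
  \int[nu i]_(x in S i) (osc dist nu F (2 ^- k) i x `^ p))%E.
(** The weight is that of scale [k] but the radius is [2 ^- k.+1]: pairs inside a ball of level
    [k.+1] are [2 ^- k]-close. *)
Let G i j k := ((2 `^ (k%:R * (p - th i - th j)))%:E *
  \int[nu i]_y pair_energy dist mu p nu F (2 ^- k.+1) i j y)%E.
Let T k := ((2 `^ (k%:R * (theta - p)))%:E *
  \sum_(i < N) (a k i)%:E * \int[nu i]_(x in S i) (e k x `^ p))%E.

Hypotheses (LY : forall i, (L i <= Y)%E)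
  (QY : forall i, (\sum_(1 <= k <oo) Q i k <= Y)%E)
  (GY : forall i j, j != i -> (\sum_(1 <= k <oo) G i j k <= Y)%E)
  (Y0 : (0 <= Y)%E).

Let L0 i : (0 <= L i)%E.
Proof. by apply: integral_ge0 => y _; rewrite lee_fin powR_ge0. Qed.

Let Q0 i k : (0 <= Q i k)%E.
Proof.
rewrite mule_ge0 ?lee_fin ?powR_ge0//; apply: integral_ge0 => x _; exact: poweR_ge0.
Qed.

Let G0 i j k : (0 <= G i j k)%E.
Proof.
rewrite mule_ge0 ?lee_fin ?powR_ge0//; apply: integral_ge0 => x _.
exact: pair_energy_ge0.
Qed.

Let T0 k : (0 <= T k)%E.
Proof.
rewrite mule_ge0 ?lee_fin ?powR_ge0//; apply: sume_ge0 => i _.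
rewrite mule_ge0 ?lee_fin ?powR_ge0//; apply: integral_ge0 => x _; exact: poweR_ge0.
Qed.

(** At level 1 the competitor [c = 0] is inserted and [power_level] bounds the term by [L_p]
    norms. *)
Let T1_le : (T 1 <= D1%:E * Y)%E.
Proof.
rewrite /T mul1r /D1 EFinM -muleA; apply: lee_wpmul2l; first by rewrite lee_fin powR_ge0.
rewrite -sumEFin ge0_sume_distrl; last by move=> i _; rewrite lee_fin mulr_ge0// ltW.
apply: lee_sum => i _; rewrite EFinM -muleA; apply: lee_wpmul2l.
  by rewrite lee_fin ltW.
have := @power_level _ _ _ dist mu dm dsep dbor N p th S nu F p1 mS mF mu_fin mu_pos
  C k1 K C1 k10 K0 HC Hlow Hup (2 ^- 1) _ (a 1) (rk 0) (powR_gt0 _ (ltr0n _ 2))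
  (aq 1) i (e 1) (e0 1).
move=> /(_ _) /le_trans; apply.
  move=> x Sx; apply: (le_trans (@He 0 i x 0 Sx)).
  rewrite le_eqVlt; apply/orP; left; apply/eqP; congr (_ * _)%E.
  apply: eq_bigr => j _; congr (_ * _)%E.
  by apply: eq_integral => z _; rewrite subr0.
rewrite EFinM -muleA; apply: lee_wpmul2l; first by rewrite lee_fin powR_ge0.
rewrite -sumEFin ge0_sume_distrl; last by move=> j _; rewrite lee_fin; exact: const1_ge0.
by apply: lee_sum => j _; apply: lee_wpmul2l;
  [rewrite lee_fin; exact: const1_ge0|exact: LY].
Qed.

(** [osc_level] is multiplied by the level weight; it remains to compare powers of 2. *)
Let T_le k : (T k.+1 <= D2%:E * \sum_(i < N) (Q i k.+1 + \sum_(j < N | j != i) G i j k))%E.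
Proof.
rewrite /T ge0_sume_distrr; last first.
  move=> i _; rewrite mule_ge0 ?lee_fin ?powR_ge0//; apply: integral_ge0 => x _.
  exact: poweR_ge0.
rewrite ge0_sume_distrr; last by move=> i _; rewrite adde_ge0// sume_ge0.
apply: lee_sum => i _.
set I := (\int[nu i]_(x in S i) (osc dist nu F (2 ^- k.+1) i x `^ p))%E.
have I0 : (0 <= I)%E by apply: integral_ge0 => x _; exact: poweR_ge0.
pose P j := (\int[nu i]_y pair_energy dist mu p nu F (2 ^- k.+1) i j y)%E.
have P0 j : (0 <= P j)%E by apply: integral_ge0 => x _; exact: pair_energy_ge0.
pose cc := C ^+ 2 * K / k1 ^+ 2.
have Hlev : (\int[nu i]_(x in S i) (e k.+1 x `^ p) <=
   cA%:E * (I + \sum_(j < N | j != i) (cc * (2 ^- k.+1) `^ th j)%:E * P j))%E.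
  apply: (@osc_level _ _ _ dist mu dm dsep dbor N p th S nu F p1 mS mF mu_fin mu_pos
    C k1 K C1 k10 K0 HC Hlow Hup (2 ^- k.+1) _ (a k.+1) (rk k)
    (powR_gt0 _ (ltr0n _ 2)) (aq k.+1) i (e k.+1) (e0 k.+1)).
  by move=> x Sx c; exact: (@He k i x c Sx).
pose X1 : R := 2 `^ (k.+1%:R * (theta - p)) * a k.+1 i.
have X1_ge0 : 0 <= X1 by rewrite mulr_ge0 ?powR_ge0// ltW.
(* The exponent of [X1] is [(k+1) * (2 * theta - p - th i)], and [theta < p]. *)
have X1le : X1 <= 2 `^ (k.+1%:R * (p - th i)).
  rewrite /X1 /a /coef -powRD; last by rewrite pnatr_eq0 implybT.
  apply: ler_powR; first by rewrite ler1n.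
  rewrite -mulrDr ler_pM2l ?ltr0n//; move: thetap; lra.
(* The exponents at [k + 1] and [k] differ by [p - th i - th j], which is below [p]. *)
have pairle j : X1 * (cc * (2 ^- k.+1) `^ th j) <=
    cc * 2 `^ p * 2 `^ (k%:R * (p - th i - th j)).
  rewrite mulrCA -[leRHS]mulrA ler_wpM2l//.
  apply: (@le_trans _ _ (2 `^ (k.+1%:R * (p - th i)) * (2 ^- k.+1) `^ th j)).
    by rewrite ler_wpM2r// powR_ge0.
  rewrite powR_invXn -!powRD; try by rewrite pnatr_eq0 implybT.
  apply: ler_powR; first by rewrite ler1n.
  rewrite -natr1; have := th0 i; have := th0 j; lra.
apply: (@le_trans _ _ (X1%:E * (cA%:E * (I + \sum_(j < N | j != i)
    (cc * (2 ^- k.+1) `^ th j)%:E * P j)))%E).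
  rewrite [X in (_ <= X * _)%E]EFinM -[leRHS]muleA.
  apply: lee_wpmul2l; first by rewrite lee_fin powR_ge0.
  by apply: lee_wpmul2l; first by rewrite lee_fin ltW.
have cP0 j : (0 <= (cc * (2 ^- k.+1) `^ th j)%:E * P j)%E.
  by rewrite mule_ge0// lee_fin mulr_ge0 ?powR_ge0.
rewrite muleCA /D2 [X in (_ <= X * _)%E]EFinM -[leRHS]muleA.
apply: lee_wpmul2l; first by rewrite lee_fin.
rewrite ge0_muleDr ?sume_ge0// [leRHS]ge0_muleDr ?sume_ge0//.
have ccp : 0 <= cc * 2 `^ p by rewrite mulr_ge0// powR_ge0.
apply: leeD.
  rewrite /Q -/I muleA -EFinM; apply: lee_wpmul2r => //; rewrite lee_fin.
  apply: (le_trans X1le); rewrite ler_peMl ?powR_ge0//.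
  by rewrite lerDl.
rewrite ge0_sume_distrr// ge0_sume_distrr//; apply: lee_sum => j _.
rewrite /G -/(P j) !muleA -!EFinM; apply: lee_wpmul2r => //; rewrite lee_fin.
by apply: (le_trans (pairle j)); rewrite ler_wpM2r ?powR_ge0// lerDr.
Qed.

(** Level 1 is split off. For each of the [N] indices [i], the later levels contribute one
    oscillation series and at most [N] gluing series, each bounded by [Y]. *)
Lemma sum_levels_le :
  (\sum_(1 <= k <oo) T k <= (D1 + D2 * (N%:R * (1 + N%:R)))%:E * Y)%E.
Proof.
rewrite -nneseries_addn// nneseries_recl// add0n EFinD ge0_muleDl; last 2 first.
- by rewrite lee_fin.
- by rewrite lee_fin mulr_ge0// mulr_ge0// addr_ge0.
apply: leeD => //.
pose V k := (\sum_(i < N) (Q i k.+1 + \sum_(j < N | j != i) G i j k))%E.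
have QG0 i k : (0 <= Q i k.+1 + \sum_(j < N | j != i) G i j k)%E.
  by rewrite adde_ge0// sume_ge0.
have V0 k : (0 <= V k)%E by apply: sume_ge0.
apply: (@le_trans _ _ (\sum_(1 <= k <oo) (D2%:E * V k))%E).
  by apply: lee_nneseries => // k _; rewrite addn1; exact: T_le.
rewrite nneseriesZl// [X in (_ <= X * _)%E]EFinM -[leRHS]muleA.
apply: lee_wpmul2l; first by rewrite lee_fin.
rewrite nneseries_sum//.
have QY' i : (\sum_(1 <= k <oo) Q i k.+1 <= Y)%E.
  exact: le_trans (nneseries_succ_le (Q0 i)) (QY i).
apply: (@le_trans _ _ (\sum_(i < N) ((1 + N%:R)%:E * Y))%E).
  apply: lee_sum => i _; rewrite nneseriesD//; last by move=> k _ _; exact: sume_ge0.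
  rewrite EFinD ge0_muleDl ?lee_fin// mul1e; apply: leeD => //.
  rewrite nneseries_sum//.
  apply: (@le_trans _ _ (\sum_(j < N | j != i) Y)%E).
    by apply: lee_sum => j; exact: GY.
  rewrite -sume_const_ord// [leRHS](bigD1 i)//= leeDr//.
rewrite sume_const_ord ?mule_ge0 ?lee_fin ?addr_ge0//.
by rewrite muleA -EFinM.
Qed.

End Fixed.

(** The constant is quantified before [F], [e] and [Y], so that it does not depend on the
    function. *)
Lemma sum_levels_bound : exists2 D : R, 0 <= D &
  forall (F : 'I_N -> X -> R) (e : nat -> X -> \bar R) (Y : \bar R),
  (forall i, measurable_fun setT (F i)) -> (forall k x, (0 <= e k x)%E) ->
  (forall k i x c, S i x ->
    (e k.+1 x <= ((fine (\sum_(j < N) (a k.+1 j)%:E * nu j (B k.+1 x)))^-1)%:E *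
     (\sum_(j < N) (a k.+1 j)%:E * \int[nu j]_(z in B k.+1 x) (`|F j z - c|)%:E))%E) ->
  (0 <= Y)%E ->
  (forall i, \int[nu i]_y (`|F i y| `^ p)%:E <= Y)%E ->
  (forall i, \sum_(1 <= k <oo) ((2 `^ (k%:R * (p - th i)))%:E *
    \int[nu i]_(x in S i) (osc dist nu F (2 ^- k) i x `^ p)) <= Y)%E ->
  (forall i j, j != i -> \sum_(1 <= k <oo) ((2 `^ (k%:R * (p - th i - th j)))%:E *
    \int[nu i]_y pair_energy dist mu p nu F (2 ^- k.+1) i j y) <= Y)%E ->
  (\sum_(1 <= k <oo) ((2 `^ (k%:R * (theta - p)))%:E *
    \sum_(i < N) (a k i)%:E * \int[nu i]_(x in S i) (e k x `^ p)) <= D%:E * Y)%E.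
Proof.
exists (D1 + D2 * (N%:R * (1 + N%:R))).
  apply: addr_ge0; first exact: D1_ge0.
  by apply: mulr_ge0; [exact: D2_ge0|rewrite mulr_ge0// addr_ge0].
by move=> F e Y mF e0 He Y0 LY QY GY; exact: (@sum_levels_le F e Y).
Qed.

End Levels.

(** * Restricted measures *)

Section Restriction.
Context {R : realType} {d0 : measure_display} {X : measurableType d0}.
Variables (H : {measure set X -> \bar R}) (S : set X) (mS : measurable S).
Variable nu : {sigma_finite_measure set X -> \bar R}.
Hypothesis nuE : (nu : set X -> \bar R) = mrestr H mS.

Lemma integral_restriction (D : set X) (g : X -> \bar R) :
  (forall x, D x -> 0 <= g x)%E ->
  (\int[nu]_(x in D) g x = \int[H]_(x in D `&` S) g x)%E.
Proof.
move=> g0; rewrite -(ge0_integral_mrestr H mS g0).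
by congr (integral _ D g); exact: nuE.
Qed.

(** [f] is measurable only on [S]; its extension by zero is measurable everywhere and gives the same
    integrals for the restricted measure. *)
Lemma integral_restriction_patch (f : X -> R) (D : set X) (phi : R -> \bar R) :
  (forall t, 0 <= phi t)%E ->
  (\int[nu]_(x in D) phi ((f \_ S) x) = \int[H]_(x in D `&` S) phi (f x))%E.
Proof.
move=> phi0; rewrite integral_restriction//; apply: eq_integral => x.
by rewrite inE => -[_ Sx]; rewrite patchE mem_set.
Qed.

End Restriction.

(** * Passing between norms and their [p]-th powers *)

Section PowerBounds.
Context {R : realType}.

Lemma poweR_inv_le (p : R) (x T : \bar R) : 0 < p -> (0 <= x)%E ->
  (x `^ p^-1 <= T)%E -> (x <= T `^ p)%E.
Proof.
move=> p0 x0 xT; have T0 : (0 <= T)%E by rewrite (le_trans _ xT)// poweR_ge0.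
have -> : x = ((x `^ p^-1) `^ p)%E.
  by rewrite -poweRrM mulVf ?gt_eqF// poweRe1.
apply: gt0_ler_poweR => //; first exact: ltW.
- by rewrite in_itv/= poweR_ge0 leey.
- by rewrite in_itv/= T0 leey.
Qed.

Lemma le_poweR_inv (p D : R) (x T : \bar R) : 0 < p -> 0 <= D ->
  (0 <= x)%E -> (0 <= T)%E -> (x <= D%:E * T `^ p)%E ->
  (x `^ p^-1 <= (D `^ p^-1)%:E * T)%E.
Proof.
move=> p0 D0 x0 T0 xDT.
have DT0 : (0 <= D%:E * T `^ p)%E by rewrite mule_ge0 ?lee_fin// poweR_ge0.
apply: (@le_trans _ _ ((D%:E * T `^ p) `^ p^-1)%E).
  apply: gt0_ler_poweR => //; first by rewrite invr_ge0 ltW.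
  - by rewrite in_itv/= x0 leey.
  - by rewrite in_itv/= DT0 leey.
rewrite poweRM ?lee_fin ?poweR_ge0// poweR_EFin -poweRrM divff ?gt_eqF// poweRe1//.
Qed.

End PowerBounds.

(** * Oscillations and gluing energies in terms of the restricted measures *)

Section Oscillation.
Context {R : realType} {d0 : measure_display} {X : measurableType d0}.

Lemma AvE_ge0 (m : set X -> \bar R) I (G : set X) (g : X -> \bar R) :
  (0 <= m G)%E -> (0 <= I G g)%E -> (0 <= AvE m I G g)%E.
Proof.
move=> m0 I0; rewrite /AvE; case: ifP => // _.
by rewrite mule_ge0// lee_fin invr_ge0 fine_ge0.
Qed.

Lemma oscE_ge0 (m : set X -> \bar R) I (f : X -> R) (G : set X) :
  (0 <= m G)%E -> (forall g, (forall x, 0 <= g x)%E -> 0 <= I G g)%E ->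
  (0 <= oscE m I f G)%E.
Proof.
move=> m0 I0; apply: le_ereal_inf_tmp => _ [c _ <-]; apply: AvE_ge0 => //.
by apply: I0 => x; rewrite lee_fin.
Qed.

End Oscillation.

Section Family.
Context {R : realType} {d0 : measure_display} {X : measurableType d0}.
Variables (N : nat) (theta : R) (th : 'I_N -> R) (S : 'I_N -> set X)
  (H : 'I_N -> {measure set X -> \bar R}) (mS : forall i, measurable (S i))
  (nu : 'I_N -> {sigma_finite_measure set X -> \bar R}).
Hypothesis nuE : forall i, (nu i : set X -> \bar R) = mrestr (H i) (mS i).

Lemma restrictionE i G : nu i G = H i (G `&` S i).
Proof. by rewrite nuE. Qed.

Lemma mk_massE k G :
  mk_mass theta th S H k G = (\sum_(j < N) (coef theta th k j)%:E * nu j G)%E.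
Proof. by apply: eq_bigr => j _; rewrite restrictionE. Qed.

Lemma mk_mass_ge0 k G : (0 <= mk_mass theta th S H k G)%E.
Proof.
rewrite mk_massE; apply: sume_ge0 => j _.
by rewrite mule_ge0 ?lee_fin ?powR_ge0//; exact: measure_ge0.
Qed.

Lemma mk_int_ge0 k G g : (forall x, 0 <= g x)%E ->
  (0 <= mk_int theta th S H k G g)%E.
Proof.
move=> g0; apply: sume_ge0 => j _.
by rewrite mule_ge0 ?lee_fin ?powR_ge0//; exact: integral_ge0.
Qed.

Lemma mk_osc_ge0 k f G :
  (0 <= oscE (mk_mass theta th S H k) (mk_int theta th S H k) f G)%E.
Proof. by apply: oscE_ge0; [exact: mk_mass_ge0|move=> g; exact: mk_int_ge0]. Qed.

(** Any [c] competes in the infimum, and positive [i]-th mass makes the total mass positive, which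
    selects the quotient branch of [AvE]. *)
Lemma mk_osc_le k f G c i : (0 < nu i G)%E ->
  (oscE (mk_mass theta th S H k) (mk_int theta th S H k) f G <=
   ((fine (\sum_(j < N) (coef theta th k j)%:E * nu j G))^-1)%:E *
   (\sum_(j < N) (coef theta th k j)%:E *
      \int[nu j]_(z in G) (`|(f \_ (S j)) z - c|)%:E))%E.
Proof.
move=> nu0; apply: ereal_inf_lbound; exists c => //; rewrite /AvE mk_massE ifT.
  congr (_ * _)%E; apply: eq_bigr => j _; congr (_ * _)%E.
  by rewrite (@integral_restriction_patch _ _ _ (H j) _ (mS j) (nu j) (nuE j) f G
    (fun t => (`|t - c|)%:E)).
apply: (@lt_le_trans _ _ ((coef theta th k i)%:E * nu i G)%E).
  by rewrite mule_gt0// lte_fin powR_gt0.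
rewrite (bigD1 i)//= leeDl//; apply: sume_ge0 => j _.
by rewrite mule_ge0 ?lee_fin ?powR_ge0//; exact: measure_ge0.
Qed.

(** Only monotonicity is involved, so [G] may be a porous part and [g] a power of an oscillation,
    measurable or not. *)
Lemma mk_int_le k (G : set X) g : (forall x, 0 <= g x)%E ->
  (mk_int theta th S H k G g <=
   \sum_(i < N) (coef theta th k i)%:E * \int[nu i]_(x in S i) g x)%E.
Proof.
move=> g0; apply: lee_sum => i _; apply: lee_wpmul2l.
  by rewrite lee_fin powR_ge0.
rewrite (integral_restriction (nuE i))// setIid.
by apply: ge0_le_integralS => // x [].
Qed.

Lemma oscE_restriction (dist : X -> X -> R) f r i x :
  (0 < nu i (cball dist x r))%E ->
  oscE (fun G => H i (G `&` S i)) (fun G g => \int[H i]_(y in G `&` S i) g y)%E f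
    (cball dist x r) = osc dist nu (fun j => f \_ (S j)) r i x.
Proof.
move=> nu0; rewrite /oscE /osc; congr ereal_inf.
apply: eq_imagel => c _; rewrite /AvE -restrictionE nu0; congr (_ * _)%E.
by rewrite (@integral_restriction_patch _ _ _ (H i) _ (mS i) (nu i) (nuE i) f _
    (fun t => (`|t - c|)%:E)).
Qed.

(** Doubling the radius of level [k.+1] gives [2 ^- k], which identifies the pair energy with the
    double integral of [GL1] at scale [k]. *)
Lemma pair_energy_restriction (dist : X -> X -> R)
    (mu : {measure set X -> \bar R}) (mu' : {sigma_finite_measure set X -> \bar R})
    (p : R) f k i j :
  (mu' : set X -> \bar R) = mu ->
  (\int[nu i]_y pair_energy dist mu' p nu (fun j => f \_ (S j)) (2 ^- k.+1) i j y =
   \int[H i]_(y in S i) \int[H j]_(z in S j)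
        (if (dist y z <= 2 ^- k)%R
         then (wk dist mu k y z * `|f y - f z| `^ p)%:E else 0))%E.
Proof.
move=> mu'E.
have r2 : 2 * 2 ^- k.+1 = 2 ^- k :> R by rewrite exprS invfM mulrA divff ?mul1r.
rewrite (integral_restriction (nuE i)); last by move=> y _; exact: pair_energy_ge0.
rewrite setTI; apply: eq_integral => y; rewrite inE => Sy.
rewrite /pair_energy (integral_restriction (nuE j)); last first.
  by move=> z _; case: ifP => // _; rewrite lee_fin mulr_ge0 ?powR_ge0.
rewrite setTI; apply: eq_integral => z; rewrite inE => Sz.
by rewrite r2 !patchE !mem_set// mu'E.
Qed.

End Family.

(** * Uniform regularity constants and the final estimate *)

Lemma uniform_ADR (R : realType) (d0 : measure_display) (X : measurableType d0)
    (dist : X -> X -> R) (mu : {measure set X -> \bar R}) (N : nat)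
    (th : 'I_N -> R) (S : 'I_N -> set X) (H : 'I_N -> {measure set X -> \bar R}) :
  is_metric dist -> borel_sets dist -> unif_loc_doubling dist mu ->
  (forall i, 0 < th i) -> (forall i, ADR dist mu (th i) (S i)) ->
  (forall i A, measurable A -> H i A = Hcont dist mu (th i) A) ->
  exists k1 K : R, [/\ 0 < k1, 0 < K,
    forall i x r, S i x -> 0 < r <= 1 ->
      ((k1 * r `^ (- th i))%:E * mu (cball dist x r) <= H i (cball dist x r `&` S i))%E &
    forall i x r, 0 < r <= 2^-1 ->
      (H i (cball dist x r `&` S i) <= (K * r `^ (- th i))%:E * mu (cball dist x r))%E].
Proof.
move=> dm dbor db th0 SADR HE.
have /choice[Kf KfP] : forall i, exists K : R, 0 < K /\ forall x r, 0 < r <= 2^-1 ->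
    (H i (cball dist x r `&` S i) <= (K * r `^ (- th i))%:E * mu (cball dist x r))%E.
  by move=> i; have [K K0 HK] := ADR_upper dm dbor db (th0 i) (SADR i) (HE i); exists K.
have /choice[kf kfP] : forall i, exists k : R, 0 < k /\ forall x r, S i x -> 0 < r <= 1 ->
    ((k * r `^ (- th i))%:E * mu (cball dist x r) <= H i (cball dist x r `&` S i))%E.
  move=> i; have [clS [k1 [k2 [k10 [k20 HS]]]]] := SADR i; exists k1; split => // x r Sx r1.
  rewrite HE; first exact: (HS x r Sx r1).1.
  by apply: measurableI; [exact: measurable_cball|exact: (measurable_dclosed dbor)].
have kV_ge0 i : 0 <= (kf i)^-1 by rewrite invr_ge0 ltW// (kfP i).1.
have Kf_ge0 i : 0 <= Kf i by rewrite ltW// (KfP i).1.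
have s0 : 0 < 1 + \sum_i (kf i)^-1 by rewrite ltr_pwDl// sumr_ge0.
(* The first constant lies below every [kf i], the second above every [Kf i]; the added 1 keeps both
   positive. *)
exists (1 + \sum_i (kf i)^-1)^-1, (1 + \sum_i Kf i); split.
- by rewrite invr_gt0.
- by rewrite ltr_pwDl// sumr_ge0.
- move=> i x r Sx r1; apply: le_trans ((kfP i).2 x r Sx r1).
  apply: lee_wpmul2r => //; rewrite lee_fin ler_wpM2r ?powR_ge0//.
  rewrite -[leRHS]invrK lef_pV2 ?posrE//; last by rewrite invr_gt0 (kfP i).1.
  by rewrite (bigD1 i)//= addrCA lerDl addr_ge0// sumr_ge0.
- move=> i x r r1; apply: (le_trans ((KfP i).2 x r r1)).
  apply: lee_wpmul2r => //; rewrite lee_fin ler_wpM2r ?powR_ge0//.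
  by rewrite (bigD1 i)//= addrCA lerDl addr_ge0// sumr_ge0.
Qed.

Theorem theorem3p12 (R : realType) (d0 : measure_display) (X : measurableType d0)
  (dist : X -> X -> R) (mu : {measure set X -> \bar R}) (p : R)
  (thlow theta : R) (N : nat) (th : 'I_N -> R) (S : 'I_N -> set X)
  (H : 'I_N -> {measure set X -> \bar R}) (sig : 'I_N -> R) :
  is_metric dist -> dcomplete dist -> dseparable dist -> borel_sets dist ->
  locally_finite dist mu -> full_support dist mu -> unif_loc_doubling dist mu ->
  1 < p -> poincare dist mu p ->
  0 <= thlow -> thlow < p -> (thlow%:E < Q_lower dist mu)%E ->
  thlow <= theta -> theta < p ->
  (2 <= N)%N ->
  (forall i, 0 < th i) ->
  (forall i j : 'I_N, (i < j)%N -> th i < th j) ->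
  (forall i : 'I_N, val i = N.-1 -> th i = thlow) ->
  (forall i, ADR dist mu (th i) (S i)) ->
  (forall i A, measurable A -> H i A = Hcont dist mu (th i) A) ->
  (forall i, 0 < sig i < 1 /\ porous dist (S i) (sig i)) ->
  forall sigma : R, 0 < sigma <= \prod_(i < N) (2 * sig i / 3) ->
  exists C : R, 0 < C /\
    forall f : X -> R, in_Lp_all p S H f ->
      (BN dist mu p theta th S H sigma f <=
        C%:E * (\sum_(i < N) Besov dist p S H i (1 - th i / p) f
                 + GL1 dist mu p th S H f))%E.
Proof.
move=> dm _ dsep dbor lf supp db p1 _ _ _ _ _ thetap _ th0 _ _ SADR HE _ sigma _.
have p0 : 0 < p by rewrite (lt_trans ltr01).
have mS i : measurable (S i) by have [clS _] := SADR i; exact: (measurable_dclosed dbor).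
have mu_fin := cball_lty dm dbor lf db.
have [C C1 HC] := doubling_near dm dbor db.
have [k1 [K [k10 K0 Hlow Hup]]] := uniform_ADR dm dbor db th0 SADR HE.
have half0 : 0 < (2^-1 : R) <= 2^-1 by rewrite invr_gt0 ltr0n lexx.
have half_gt0 : 0 < (2^-1 : R) by case/andP : half0.
have H_fin i x : (H i (cball dist x 2^-1 `&` S i) < +oo)%E.
  apply: (le_lt_trans (Hup i x _ half0)).
  have : mu (cball dist x 2^-1) \is a fin_num by rewrite ge0_fin_numE.
  by move=> /fineK <-; rewrite -EFinM ltry.
have [mu' mu'E] := sigma_finite_measure_of
  (sigma_finite_cball dm dsep dbor half_gt0 (fun x => mu_fin x _)).
(* [H i] may fail to be sigma-finite on [X], but its restriction to [S i] is finite on balls of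
   radius 1/2. *)
have /choice[nu nuE] : forall i, exists nu : {sigma_finite_measure set X -> \bar R},
    (nu : set X -> \bar R) = mrestr (H i) (mS i).
  move=> i; apply: (@sigma_finite_measure_of _ _ _ (mrestr (H i) (mS i))).
  by apply: (sigma_finite_cball dm dsep dbor half_gt0) => x; exact: H_fin.
have mu'_fin x r : (mu' (cball dist x r) < +oo)%E by rewrite mu'E.
have mu'_pos x r : 0 < r -> (0 < mu' (cball dist x r))%E.
  by move=> r0; rewrite mu'E; exact: supp.
have HC' x y r : 0 < r <= 1 -> dist x y <= 2 * r ->
    (mu' (cball dist y (2 * r)) <= C%:E * mu' (cball dist x r))%E.
  by rewrite mu'E; exact: HC.
have Hlow' i x r : S i x -> 0 < r <= 1 ->
    ((k1 * r `^ (- th i))%:E * mu' (cball dist x r) <= nu i (cball dist x r))%E.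
  by rewrite mu'E nuE; exact: Hlow.
have Hup' i x r : 0 < r <= 2^-1 ->
    (nu i (cball dist x r) <= (K * r `^ (- th i))%:E * mu' (cball dist x r))%E.
  by rewrite mu'E nuE; exact: Hup.
have nu_pos i x k : S i x -> (0 < nu i (cball dist x (2 ^- k)))%E.
  move=> Sx; have rk0 : 0 < (2 ^- k : R) by rewrite invr_gt0 exprn_gt0.
  apply: lt_le_trans (Hlow' i x (2 ^- k) Sx _).
    by rewrite mule_gt0 ?mu'_pos// lte_fin mulr_gt0// powR_gt0.
  by rewrite rk0 invf_le1 ?exprn_gt0// exprn_ege1// ler1n.
have [D D0 HD] := sum_levels_bound dm dsep dbor p1 thetap th0 mS mu'_fin mu'_pos
  C1 k10 K0 HC' Hlow' Hup'.
(* Each piece of [S i] in a ball of radius 1/2 has finite content, hence is null, and countably many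
   such balls cover [X]. *)
have mu_S i : mu (S i) = 0%E.
  apply: (null_set_cball dm dsep dbor half_gt0 (mS i)) => x.
  have mB : measurable (cball dist x 2^-1 `&` S i).
    by apply: measurableI => //; exact: measurable_cball.
  by apply: (Hcont_lty_null dm dbor (th0 i) mB); rewrite -HE.
have mSall : measurable (Sall S).
  by apply: fin_bigcup_measurable => // i _; exact: mS.
have mu_Sall : mu (Sall S) = 0%E.
  apply: measure_negligible => //.
  (* The finite family is padded with empty sets to a sequence. *)
  pose G n := if insub n is Some i then S i else set0.
  apply: (@negligibleS _ _ _ mu (\bigcup_n G n)).
    by move=> x [i _ Sx]; exists (val i) => //; rewrite /G valK.
  apply: negligible_bigcup => n; rewrite /G; case: insubP => [i _ _|_].
    by exists (S i); split.
  exact: negligible_set0.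
(* One summand for the [L_p] term, one for the sum over scales; the 1 ensures positivity. *)
exists (N%:R `^ p^-1 + D `^ p^-1 + 1).
have c0 : 0 <= N%:R `^ p^-1 + D `^ p^-1 by rewrite addr_ge0// powR_ge0.
split=> [|f fLp]; first by rewrite ltr_wpDl.
pose F i : X -> R := f \_ (S i).
have mF i : measurable_fun setT (F i).
  by apply/(measurable_restrictT _ (mS i)); exact: (fLp i).1.
set T := (\sum_(i < N) _ + _)%E.
have Bes0 i : (0 <= Besov dist p S H i (1 - th i / p) f)%E.
  by rewrite adde_ge0// poweR_ge0.
have GL0 : (0 <= GL1 dist mu p th S H f)%E by exact: poweR_ge0.
have T0 : (0 <= T)%E by rewrite adde_ge0// sume_ge0.
have BesT i : (Besov dist p S H i (1 - th i / p) f <= T)%E.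
  rewrite /T (bigD1 i)//= -addeA leeDl// adde_ge0// sume_ge0//.
have GLT : (GL1 dist mu p th S H f <= T)%E by rewrite /T leeDr// sume_ge0.
pose L i := (\int[H i]_(x in S i) (`|f x| `^ p)%:E)%E.
have L0 i : (0 <= L i)%E by apply: integral_ge0 => x _; rewrite lee_fin powR_ge0.
have LT i : (L i <= T `^ p)%E.
  apply: poweR_inv_le => //; apply: le_trans (BesT i).
  by rewrite leeDl// poweR_ge0.
pose e k x := oscE (mk_mass theta th S H k) (mk_int theta th S H k) f
  (cball dist x (2 ^- k)).
have e0 k x : (0 <= e k x)%E by exact: (mk_osc_ge0 theta th nuE).
have T30 k : (0 <= (2 `^ (k%:R * (theta - p)))%:E *
    mk_int theta th S H k (porous_part dist (Sall S) sigma (2 ^- k))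
      (fun x => e k x `^ p))%E.
  rewrite mule_ge0 ?lee_fin ?powR_ge0//; apply: mk_int_ge0 => x; exact: poweR_ge0.
have third : (\sum_(1 <= k <oo) (2 `^ (k%:R * (theta - p)))%:E *
    mk_int theta th S H k (porous_part dist (Sall S) sigma (2 ^- k))
      (fun x => e k x `^ p) <= D%:E * T `^ p)%E.
  apply: (@le_trans _ _ (\sum_(1 <= k <oo) ((2 `^ (k%:R * (theta - p)))%:E *
      \sum_(i < N) (coef theta th k i)%:E * \int[nu i]_(x in S i) (e k x `^ p)))%E).
    apply: lee_nneseries => // k _; apply: lee_wpmul2l.
      by rewrite lee_fin powR_ge0.
    by apply: (mk_int_le theta th nuE) => x; exact: poweR_ge0.
  apply: (HD F e (T `^ p)%E mF e0).
  - move=> k i x c Sx; apply: (mk_osc_le theta th nuE) (nu_pos i x _ Sx).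
  - exact: poweR_ge0.
  - move=> i; rewrite (@integral_restriction_patch _ _ _ (H i) _ (mS i) (nu i) (nuE i) f
      setT (fun t => (`|t| `^ p)%:E)); last by move=> t; rewrite lee_fin powR_ge0.
    by rewrite setTI; exact: LT.
  - move=> i; apply: poweR_inv_le => //.
      apply: nneseries_ge0 => k _ _; rewrite mule_ge0 ?lee_fin ?powR_ge0//.
      by apply: integral_ge0 => x _; exact: poweR_ge0.
    apply: le_trans (BesT i); rewrite /Besov.
    rewrite (_ : \sum_(1 <= k <oo) _ = \sum_(1 <= k <oo)
      (2 `^ (k%:R * (1 - th i / p) * p))%:E *
        \int[H i]_(x in S i)
          (oscE (fun G => H i (G `&` S i))
                (fun G g => \int[H i]_(y in G `&` S i) g y)
                f (cball dist x (2 ^- k)) `^ p))%E.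
      by rewrite leeDr// poweR_ge0.
    (* The weights agree because [(1 - th i / p) * p = p - th i]. *)
    apply: eq_eseriesr => k _; congr (_ * _)%E.
      by congr ((2 `^ _)%:E); field; rewrite gt_eqF.
    rewrite (integral_restriction (nuE i)) ?setIid; last first.
      by move=> x _; exact: poweR_ge0.
    apply: eq_integral => x; rewrite inE => Sx.
    by rewrite -(oscE_restriction nuE)//; exact: nu_pos.
  - move=> i j ji.
    have G0 i' j' k : (0 <= (2 `^ (k%:R * (p - th i' - th j')))%:E *
        \int[H i']_(y in S i') \int[H j']_(z in S j')
          (if (dist y z <= 2 ^- k)%R
           then (wk dist mu k y z * `|f y - f z| `^ p)%:E else 0))%E.
      rewrite mule_ge0 ?lee_fin ?powR_ge0//; apply: integral_ge0 => y _.
      by apply: integral_ge0 => z _; case: ifP => // _; rewrite lee_fin mulr_ge0 ?powR_ge0.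
    under eq_eseriesr do rewrite (pair_energy_restriction nuE dist p f _ i j mu'E).
    apply: poweR_inv_le => //; first by apply: nneseries_ge0.
    apply: le_trans GLT; apply: gt0_ler_poweR.
    + by rewrite invr_ge0 ltW.
    + by rewrite in_itv/= leey andbT; apply: nneseries_ge0.
    + rewrite in_itv/= leey andbT; apply: sume_ge0 => i' _; apply: sume_ge0 => j' _.
      exact: nneseries_ge0.
    (* The series for the pair [(i, j)] is one summand of the nonnegative double sum inside
       [GL1]. *)
    rewrite (bigD1 i)//= (bigD1 j)/=; last by rewrite eq_sym.
    rewrite -addeA leeDl// adde_ge0// sume_ge0// => i' _.
      exact: nneseries_ge0.
    by apply: sume_ge0 => j' _; exact: nneseries_ge0.
have first_term : (mk_int theta th S H 0 [set: X] (fun x => (`|f x| `^ p)%:E)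
    <= N%:R%:E * T `^ p)%E.
  rewrite -sume_const_ord ?poweR_ge0//; apply: lee_sum => i _.
  by rewrite /coef mul0r powRr0 mul1e setTI; exact: LT.
(* The [fsharp] term is an integral over the [mu]-null set [Sall S]. *)
rewrite /BN (ge0_null_set_integral mSall mu_Sall); last by move=> x _; exact: poweR_ge0.
rewrite poweR0r ?invr_eq0 ?gt_eqF// adde0.
apply: (@le_trans _ _ ((N%:R `^ p^-1)%:E * T + (D `^ p^-1)%:E * T)%E).
  apply: leeD; apply: le_poweR_inv => //.
    by apply: mk_int_ge0 => x; rewrite lee_fin powR_ge0.
  by apply: nneseries_ge0.
rewrite -ge0_muleDl ?lee_fin ?powR_ge0// -EFinD.
by apply: lee_wpmul2r => //; rewrite lee_fin lerDl.
Qed.
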